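(* For all $p\in(0,1)$ and $t>0$ there exists $\theta=\theta(p,t)>0$ such that for all functions $f,g:\{0,1\}^{\mathbb{N}}\to\mathbb{R}$ with $f(X),g(X)$ of finite variance, \[ \operatorname{Cov}\big(f(X),g(X^t)\big)\le\sqrt{\operatorname{Var}(f)\operatorname{Var}(g)}^{\,1-\theta}\Big(\sum_{i\in\mathbb{N}}I_i(f)I_i(g)\Big)^{\theta}. \] Moreover the statement holds with $\theta(p,t)=\tanh(\rho t/2)$, where $\rho=1$ if $p=1/2$ and $\rho=2\frac{2p-1}{\log p-\log(1-p)}$ otherwise.
   Context: $\mathbb{N}=\{0,1,2,\dots\}$. Let $X=(X_i)_{i\in\mathbb{N}}$ and $X'=(X'_i)_{i\in\mathbb{N}}$ be independent families of i.i.d. Bernoulli($p$) variables and $(U_i)_{i\in\mathbb{N}}$ i.i.d. exponential variables of mean $1$, independent of them. For $t\ge0$ define $X^t_i=X_i$ if $t<U_i$ and $X^t_i=X'_i$ if $t\ge U_i$. $\operatorname{Var}(f)$ denotes $\operatorname{Var}(f(X))$. The influence of $i$ on $f$ is $I_i(f)=\mathbb{E}\big[\big|\mathbb{E}[f(X)\mid (X_j)_{j\ne i}]-f(X)\big|\big]$. *)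

(* Defs.v *)
From HB Require Import structures.
From mathcomp Require Import all_boot all_order all_algebra.
From mathcomp Require Import all_classical all_reals all_analysis.
Set Implicit Arguments. Unset Strict Implicit. Unset Printing Implicit Defensive.
Import Order.TTheory GRing.Theory Num.Def Num.Theory.
Import numFieldNormedType.Exports.
Local Open Scope classical_set_scope.
Local Open Scope ring_scope.

Definition cylinders : set (set (nat -> bool)) :=
  [set A | exists i b, A = [set x | x i = b]].
Definition Cantor := g_sigma_algebraType cylinders.

Definition tanh {R : realType} (x : R) : R :=
  (expR x - expR (- x)) / (expR x + expR (- x)).

Definition rho {R : realType} (p : R) : R :=
  if p == 2^-1 then 1 else 2 * (2 * p - 1) / (ln p - ln (1 - p)).

Definition theta {R : realType} (p t : R) : R := tanh (rho p * t / 2).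

Section prob_defs.
Context {d : measure_display} {Omega : measurableType d} {R : realType}.
Variable P : probability Omega R.

Definition sigma_of {d'} {T' : measurableType d'} (Y : Omega -> T') : set (set Omega) :=
  [set A | exists2 B : set T', measurable B & A = Y @^-1` B].

Definition mutually_independent {I : eqType} (E : I -> set (set Omega)) : Prop :=
  forall (s : seq I) (A : I -> set Omega), uniq s ->
    (forall i, i \in s -> E i (A i)) ->
    P (\big[setI/setT]_(i <- s) A i) = (\prod_(i <- s) P (A i))%E.

Definition is_cond_exp (G : set (set Omega)) (Y h : Omega -> R) : Prop :=
  [/\ (forall B : set R, measurable B -> G (h @^-1` B)),
      P.-integrable setT (EFin \o h) &
      forall A, G A -> (\int[P]_(w in A) (h w)%:E = \int[P]_(w in A) (Y w)%:E)%E].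

Definition sigma_but (X : nat -> Omega -> bool) (i : nat) : set (set Omega) :=
  <<s \bigcup_(j in [set j | j <> i]) sigma_of (X j) >>.

(** influence I_i(f) = E | E[f(X) | (X_j)_{j<>i}] - f(X) |, computed from a
    version h of the conditional expectation *)
Definition influence (Y h : Omega -> R) : \bar R :=
  'E_P[fun w => `| h w - Y w |].

End prob_defs.

Definition vec {Omega : Type} (X : nat -> Omega -> bool) : Omega -> Cantor :=
  fun w i => X i w.
Definition noised {Omega : Type} {R : realType} (t : R)
  (X X' : nat -> Omega -> bool) (U : nat -> Omega -> R) : Omega -> Cantor :=
  fun w i => if t < U i w then X i w else X' i w.

(** tags for the independent families X, X', U *)
Inductive src := srcX | srcX' | srcU.
Definition src_eqb (a b : src) : bool :=
  match a, b with srcX, srcX | srcX', srcX' | srcU, srcU => true | _, _ => false end.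
Lemma src_eqP : Equality.axiom src_eqb.
Proof. by case; case; constructor. Qed.
HB.instance Definition _ := hasDecEq.Build src src_eqP.

(* Main.v *)
Require Import Defs.
From HB Require Import structures.
From mathcomp Require Import all_boot all_order all_algebra.
From mathcomp Require Import all_classical all_reals all_analysis.
From mathcomp Require Import measurable_realfun.
From mathcomp Require Import ring lra zify.
Set Implicit Arguments. Unset Strict Implicit. Unset Printing Implicit Defensive.
Import Order.TTheory GRing.Theory Num.Def Num.Theory.
Import numFieldNormedType.Exports.
Local Open Scope classical_set_scope.
Local Open Scope ring_scope.

(**
Conditioning on the first [n] bits contracts variances and influences, and
cylinder functions are dense in L^2, so it suffices to bound the covariance of
functions [F], [G] of [n] bits. Averaging out the bits one at a time decomposes
[F - E F] into martingale differences [d_i F] with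
[Cov (F(X), G(X^t)) = sum_i E [d_i F(X) d_i G(X^t)]],
[sum_i ||d_i F||_2^2 = Var F] and [||d_i F||_1 <= I_i F].
By hypercontractivity each term is at most [||d_i F||_q ||d_i G||_q] with
[q = 1 + exp (- rho t)]; interpolating [L^q] between [L^1] and [L^2] gives the
exponent [theta = (2 - q) / q = tanh (rho t / 2)], and Hoelder's and
Cauchy-Schwarz's inequalities sum up the terms. Hypercontractivity tensorizes
from a single bit, where it follows, by Gross's argument, from the logarithmic
Sobolev inequality with its optimal constant.
*)

(** * Derivatives on an interval *)

(** The exponent [q] comes from halving the noise: noise over time [t] pairs in L^2 the two
    functions smoothed over time [t / 2] each, so it suffices that smoothing over [t / 2] maps L^q
    to L^2. Gross's argument lets the exponent grow by [q' = 2 rho (q - 1)]; to end at 2 it must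
    start at [1 + exp (- rho t)]. The rate [rho] is 2 over the logarithmic Sobolev constant of a
    biased bit, [(ln (1 - p) - ln p) / (1 - 2 p)], or 2 at [p = 1/2]. Reaching exactly this constant
    is the delicate point: the inequality is read as positivity of a quadratic form in the two
    values, and its discriminant condition is a one-variable inequality with equality at [p] and at
    [1 - p]. Martingale differences are needed because the influences do not control the L^1 norm of
    [F - E F] term by term, whereas [d_i F] is an average of the change at bit [i]. For infinitely
    many bits no martingale convergence is invoked: the conditional mean is the best prefix
    approximation in L^2, so density of cylinder functions is enough. *)

Section calculus.
Context {R : realType}.
Implicit Types (f g : R -> R) (x a b df dg : R).

Lemma is_derive_addf f g x df dg : is_derive x 1 f df -> is_derive x 1 g dg ->
  is_derive x 1 (fun z => f z + g z) (df + dg).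
Proof. by move=> hf hg; exact: is_deriveD. Qed.

Lemma is_derive_subf f g x df dg : is_derive x 1 f df -> is_derive x 1 g dg ->
  is_derive x 1 (fun z => f z - g z) (df - dg).
Proof. by move=> hf hg; exact: is_deriveB. Qed.

Lemma is_derive_mulf f g x df dg : is_derive x 1 f df -> is_derive x 1 g dg ->
  is_derive x 1 (fun z => f z * g z) (f x * dg + g x * df).
Proof. by move=> hf hg; exact: is_deriveM. Qed.

Lemma is_derive_constf c x : is_derive x 1 (fun=> c : R) (0 : R).
Proof. exact: is_derive_cst. Qed.

Lemma is_derive_idf x : is_derive x 1 (fun z : R => z) (1 : R).
Proof. exact: is_derive_id. Qed.

Lemma is_derive_expf f x df : is_derive x 1 f df ->
  is_derive x 1 (fun z => expR (f z)) (expR (f x) * df).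
Proof. by move=> hf; exact: (@is_derive1_comp R expR f x _ _ (is_derive_expR _) hf). Qed.

Lemma is_derive_lnf f x df : 0 < f x -> is_derive x 1 f df ->
  is_derive x 1 (fun z => ln (f z)) ((f x)^-1 * df).
Proof. by move=> f0 hf; exact (@is_derive1_comp R (@ln R) f x _ _ (is_derive1_ln f0) hf). Qed.

Lemma is_derive_invf f x df : f x != 0 -> is_derive x 1 f df ->
  is_derive x 1 (fun z => (f z)^-1) (- (f x) ^- 2 * df).
Proof. by move=> f0 hf; exact: is_deriveV. Qed.

(** Separates finding a derivative, whose value [derive] obtains by unification, from simplifying
    it. *)
Lemma is_derive_eqf f x df dg : is_derive x 1 f df -> df = dg -> is_derive x 1 f dg.
Proof. by move=> ? <-. Qed.

Lemma mean_value f (df : R -> R) a b : a <= b ->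
  (forall x, a <= x <= b -> is_derive x 1 f (df x)) ->
  exists2 c, a <= c <= b & f b - f a = df c * (b - a).
Proof.
move=> ab h; have [||c cab e] := @MVT_segment R f df a b ab.
- by move=> x; rewrite in_itv/= => /andP[ax xb]; apply: h; rewrite !ltW.
- apply: derivable_within_continuous => x; rewrite in_itv/= => xab.
  by have [] := h _ xab.
- by exists c => //; rewrite in_itv/= in cab.
Qed.

Lemma nondecreasing_by_derive f (df : R -> R) a b : a <= b ->
  (forall x, a <= x <= b -> is_derive x 1 f (df x)) ->
  (forall x, a <= x <= b -> 0 <= df x) -> f a <= f b.
Proof.
move=> ab h h0; have [c cab e] := mean_value ab h.
by rewrite -subr_ge0 e mulr_ge0 ?subr_ge0 // h0.
Qed.

Lemma nonincreasing_by_derive f (df : R -> R) a b : a <= b ->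
  (forall x, a <= x <= b -> is_derive x 1 f (df x)) ->
  (forall x, a <= x <= b -> df x <= 0) -> f b <= f a.
Proof.
move=> ab h h0; have [c cab e] := mean_value ab h.
by rewrite -subr_le0 e mulr_le0_ge0 ?subr_ge0 // h0.
Qed.

(** If the slope at a mean value point left of [x] is nonnegative, [f] has climbed from 0 at [a];
    otherwise the slope right of [x] is negative too, and [f] still has to descend to 0 at [b]. *)
Lemma concave_chord_ge0 f (df : R -> R) a b x : a <= x <= b ->
  (forall y, a <= y <= b -> is_derive y 1 f (df y)) ->
  (forall y z, a <= y -> y <= z -> z <= b -> df z <= df y) ->
  f a = 0 -> f b = 0 -> 0 <= f x.
Proof.
move=> /andP[ax xb] h hd fa fb.
have [|c /andP[ac cx] e1] := @mean_value f df a x ax.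
  by move=> y /andP[ay yx]; apply: h; rewrite ay (le_trans yx).
have [|e /andP[xe eb] e2] := @mean_value f df x b xb.
  by move=> y /andP[ay yx]; apply: h; rewrite yx (le_trans ax).
have := hd _ _ ac (le_trans cx xe) eb.
rewrite fa subr0 in e1; rewrite fb sub0r in e2 => hle.
case: (leP 0 (df c)) => [c0|c0]; first by rewrite e1 mulr_ge0// subr_ge0.
by rewrite -[f x]opprK e2 oppr_ge0 mulr_le0_ge0 ?subr_ge0// (le_trans hle) ?ltW.
Qed.

End calculus.

Ltac derive := first [
    exact: is_derive_idf | exact: is_derive_constf
  | eapply is_derive_subf | eapply is_derive_addf | eapply is_derive_mulf
  | eapply is_derive_expf | eapply is_derive_lnf | eapply is_derive_invf ].

(** * Hypercontractivity on two points *)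

Section log_sobolev.
Context {R : realType}.
Variables (p c : R).
Hypothesis hp : 0 < p < 1.
Hypothesis hc : c * (1 - p - p) = ln (1 - p) - ln p.
Hypothesis hc2 : 2 <= c.

Let L1 (x : R) : R := ln x - ln p.
Let L2 (x : R) : R := ln (1 - x) - ln (1 - p).
(** The goal is [G >= 0]. [H] is [x (1 - x)] times the derivative of [G], and [dH] is the derivative
    of [H]. As [dH] is a decreasing function of [x (1 - x)], [H] is concave left of 1/2 and convex
    right of it. *)
Let G (x : R) : R := L1 x * L2 x - c * (p * L1 x + (1 - p) * L2 x).
Let H (x : R) : R := (1 - x) * L2 x - x * L1 x + c * (x - p).
Let dH (x : R) : R := c - 2 - (L1 x + L2 x).

Let derG (x : R) : 0 < x < 1 -> is_derive x 1 G (H x / (x * (1 - x))).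
Proof.
move=> /andP[x0 x1]; apply: is_derive_eqf.
  rewrite /G /L1 /L2; repeat derive; lra.
rewrite /H /L1 /L2; field; lra.
Qed.

Let derH (x : R) : 0 < x < 1 -> is_derive x 1 H (dH x).
Proof.
move=> /andP[x0 x1]; apply: is_derive_eqf.
  rewrite /H /L1 /L2; repeat derive; lra.
rewrite /dH /L1 /L2; field; lra.
Qed.

Let dHE (x : R) : 0 < x < 1 -> dH x = c - 2 - (ln (x * (1 - x)) - ln (p * (1 - p))).
Proof.
move=> /andP[x0 x1]; move: hp => /andP[p0 p1].
by rewrite /dH /L1 /L2 !lnM ?posrE ?subr_gt0//; ring.
Qed.

Let dH_le (x y : R) : 0 < x < 1 -> 0 < y < 1 -> x * (1 - x) <= y * (1 - y) -> dH y <= dH x.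
Proof.
move=> hx hy xy; rewrite !dHE// lerD2l lerN2 lerD2r ler_ln// posrE mulr_gt0//; lra.
Qed.

Let Hp : H p = 0. Proof. rewrite /H /L1 /L2; ring. Qed.
Let Gp : G p = 0. Proof. rewrite /G /L1 /L2; ring. Qed.
Let Hq : H (1 - p) = 0.
Proof.
rewrite /H /L1 /L2 (_ : 1 - (1 - p) = p); last ring.
transitivity (- (ln (1 - p) - ln p) + c * (1 - p - p)); first ring.
by rewrite hc; ring.
Qed.
Let Gq : G (1 - p) = 0.
Proof.
rewrite /G /L1 /L2 (_ : 1 - (1 - p) = p); last ring.
transitivity ((ln (1 - p) - ln p) * (c * (1 - p - p) - (ln (1 - p) - ln p))); first ring.
by rewrite hc; ring.
Qed.
Let Hhalf : H (2^-1) = 0.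
Proof.
rewrite /H /L1 /L2 (_ : 1 - 2^-1 = 2^-1 :> R); last lra.
transitivity (2^-1 * (c * (1 - p - p) - (ln (1 - p) - ln p))); first lra.
by rewrite hc; ring.
Qed.

Let den_ge0 (x : R) : 0 < x < 1 -> 0 <= (x * (1 - x))^-1.
Proof. by move=> /andP[x0 x1]; rewrite invr_ge0 mulr_ge0// ?subr_ge0 ltW. Qed.

(** The zeros [p], 1/2 and [1 - p] of [H], with its concavity or convexity between them, give its
    sign, hence the monotonicity of [G], which vanishes at [p] and [1 - p]. *)
Lemma log_ratio_product_ge (x : R) : p <= x < 1 ->
  c * (p * (ln x - ln p) + (1 - p) * (ln (1 - x) - ln (1 - p)))
  <= (ln x - ln p) * (ln (1 - x) - ln (1 - p)).
Proof.
move=> /andP[px x1]; move: hp => /andP[p0 p1]; rewrite -subr_ge0 -/(G x).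
have incG a b : 0 < a -> a <= b -> b < 1 -> (forall y, a <= y <= b -> 0 <= H y) ->
    G a <= G b.
  move=> a0 ab b1 h; apply: (@nondecreasing_by_derive _ _ (fun x => H x / (x * (1 - x)))) => //.
    by move=> y /andP[ay yb]; apply: derG; lra.
  by move=> y hy; rewrite mulr_ge0 ?h// den_ge0//; lra.
(* For [p >= 1/2], [H] is convex on [[p, 1)] with [H p = 0] and [dH p = c - 2 >= 0], so [G]
   increases from 0. *)
case: (leP (2^-1) p) => hp2.
  rewrite -Gp; apply: incG => // y /andP[py yx]; rewrite -Hp.
  apply: (@nondecreasing_by_derive _ _ dH) => //.
    by move=> z hz; apply: derH; lra.
  move=> z hz; apply: (@le_trans _ _ (dH p)); last by apply: dH_le; nra.
  by rewrite /dH /L1 /L2 !subrr addr0 subr0 subr_ge0.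
(* [H] is concave between its zeros [p] and 1/2, hence nonnegative: [G] increases from [G p = 0]. *)
case: (leP x (2^-1)) => hx2.
  rewrite -Gp; apply: incG => // y hy.
  apply: (@concave_chord_ge0 _ H dH p (2^-1)) => //; first lra.
    by move=> z hz; apply: derH; lra.
  by move=> z w hz hzw hw; apply: dH_le; nra.
(* [H] is convex between its zeros 1/2 and [1 - p], hence nonpositive: [G] decreases to
   [G (1 - p) = 0]. *)
case: (leP x (1 - p)) => hxq.
  rewrite -Gq.
  apply: (@nonincreasing_by_derive _ _ (fun x => H x / (x * (1 - x)))) => //.
    by move=> y hy; apply: derG; lra.
  move=> y hy; rewrite mulr_le0_ge0 ?den_ge0//; last lra.
  rewrite -subr_ge0; apply: (@concave_chord_ge0 _ (fun z => 0 - H z) (fun z => 0 - dH z) (2^-1) (1 - p) y).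
  - lra.
  - by move=> z hz; derive; [exact: is_derive_constf|apply: derH; lra].
  - by move=> z w hz hzw hw; rewrite lerD2l lerN2; apply: dH_le; nra.
  - by rewrite Hhalf subrr.
  - by rewrite Hq subrr.
(* Rolle's theorem gives [dH e = 0] for some [e] between 1/2 and [1 - p]; by convexity [dH] is
   nonnegative beyond [1 - p], and so is [H]. *)
rewrite -Gq; apply: incG => //; [lra|lra|move=> y /andP[qy yx]].
have [||e he e1] := @mean_value _ H dH (2^-1) (1 - p); [lra|by move=> z hz; apply: derH; lra|].
have [||e' he' e2] := @mean_value _ H dH (1 - p) y; [lra|by move=> z hz; apply: derH; lra|].
rewrite Hq subr0 in e2; rewrite Hq Hhalf subrr in e1.
have de0 : dH e = 0.
  have /eqP : dH e * (1 - p - 2^-1) = 0 by rewrite -e1.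
  by rewrite mulf_eq0 => /orP[/eqP//|/eqP]; lra.
rewrite e2; apply: mulr_ge0; last by rewrite subr_ge0.
apply: (@le_trans _ _ (dH e)); first by rewrite de0.
by apply: dH_le; nra.
Qed.

End log_sobolev.

(** * Logarithmic Sobolev and Stroock-Varopoulos inequalities for one bit *)

Section two_point.
Context {R : realType}.
Implicit Types (p c x y q : R).

(** The gap between the two sides is a quadratic form in [x] and [y] whose coefficients involve only
    the logarithms [l1] and [l2]. It is nonnegative because the product of its diagonal coefficients
    dominates the square of the cross one; this is [log_ratio_product_ge] at the tilted weight
    [p X / M], which is at least [p] as [y <= x]. *)
Let log_sobolev_le p c x y : 0 < p < 1 ->
  c * (1 - p - p) = ln (1 - p) - ln p -> 2 <= c -> 0 < y -> y <= x ->
  p * x ^+ 2 * ln (x ^+ 2) + (1 - p) * y ^+ 2 * ln (y ^+ 2)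
    - (p * x ^+ 2 + (1 - p) * y ^+ 2) * ln (p * x ^+ 2 + (1 - p) * y ^+ 2)
  <= c * (p * (1 - p)) * (x - y) ^+ 2.
Proof.
move=> hp hc hc2 y0 yx; have /andP[p0 p1] := hp; have x0 : 0 < x by lra.
have q0 : 0 < 1 - p by lra.
set X := x ^+ 2; set Y := y ^+ 2; set M := p * X + (1 - p) * Y.
have X0 : 0 < X by rewrite exprn_gt0.
have Y0 : 0 < Y by rewrite exprn_gt0.
have YX : Y <= X by rewrite /X /Y; nra.
have M0 : 0 < M by rewrite /M; nra.
have MX : M <= X by rewrite /M; nra.
have YM : Y <= M by rewrite /M; nra.
have hP : p <= p * X / M < 1.
  rewrite ler_pdivlMr// ltr_pdivrMr// mul1r {2}/M ltrDl mulr_gt0// andbT.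
  by rewrite ler_pM2l.
have := log_ratio_product_ge hp hc hc2 hP.
have -> : 1 - p * X / M = (1 - p) * Y / M by rewrite {1 2}/M; field; rewrite -/M gt_eqF.
have lnE u v : 0 < u -> 0 < v -> ln (u * v / M) - ln u = ln v - ln M.
  by move=> u0 v0; rewrite ln_div ?posrE ?mulr_gt0// lnM ?posrE//; ring.
rewrite !lnE//; set l1 := ln X - ln M; set l2 := ln Y - ln M => hl.
have l2_le : l2 <= 0 by rewrite subr_le0 ler_ln.
have B0 : 0 < c * p - l2 by nra.
(* Expanding the product turns this into [hl]. *)
have AB : c ^+ 2 * (p * (1 - p)) <= (c * (1 - p) - l1) * (c * p - l2) by nra.
have A0 : 0 < c * (1 - p) - l1.
  have : 0 < (c * (1 - p) - l1) * (c * p - l2).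
    by apply: lt_le_trans AB; rewrite !mulr_gt0 ?exprn_gt0//; lra.
  by rewrite pmulr_lgt0.
rewrite -subr_ge0.
have -> : c * (p * (1 - p)) * (x - y) ^+ 2 -
   (p * X * ln X + (1 - p) * Y * ln Y - M * ln M) =
   p * X * (c * (1 - p) - l1) + (1 - p) * Y * (c * p - l2) - 2 * c * (p * (1 - p)) * (x * y).
  by rewrite /l1 /l2 /M /X /Y; ring.
rewrite subr_ge0 -ler_sqr ?nnegrE; first last.
- by rewrite addr_ge0// !mulr_ge0// ltW.
- by rewrite !mulr_ge0//; lra.
(* AM-GM: (u + v)^2 >= 4 u v *)
apply: (@le_trans _ _ (4 * (p * X * (c * (1 - p) - l1)) * ((1 - p) * Y * (c * p - l2)))); last first.
  rewrite -subr_ge0; set u := p * X * _; set v := (1 - p) * Y * _.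
  by have -> : (u + v) ^+ 2 - 4 * u * v = (u - v) ^+ 2; [ring|rewrite sqr_ge0].
have -> : (2 * c * (p * (1 - p)) * (x * y)) ^+ 2 =
  (4 * p * X * (1 - p) * Y) * (c ^+ 2 * (p * (1 - p))) by rewrite /X /Y; ring.
have -> : 4 * (p * X * (c * (1 - p) - l1)) * ((1 - p) * Y * (c * p - l2)) =
  (4 * p * X * (1 - p) * Y) * ((c * (1 - p) - l1) * (c * p - l2)) by ring.
by rewrite ler_pM2l// !mulr_gt0.
Qed.

Lemma two_point_log_sobolev p c x y : 0 < p < 1 ->
  c * (1 - p - p) = ln (1 - p) - ln p -> 2 <= c -> 0 < x -> 0 < y ->
  p * x ^+ 2 * ln (x ^+ 2) + (1 - p) * y ^+ 2 * ln (y ^+ 2)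
    - (p * x ^+ 2 + (1 - p) * y ^+ 2) * ln (p * x ^+ 2 + (1 - p) * y ^+ 2)
  <= c * (p * (1 - p)) * (x - y) ^+ 2.
Proof.
move=> hp hc hc2 x0 y0; case: (leP y x) => yx; first exact: log_sobolev_le.
have := @log_sobolev_le (1 - p) c y x.
have -> : 1 - (1 - p) = p by ring.
have -> : (y - x) ^+ 2 = (x - y) ^+ 2 by ring.
have -> : (1 - p) * p = p * (1 - p) by ring.
rewrite [(1 - p) * y ^+ 2 + _]addrC [(1 - p) * y ^+ 2 * _ + _]addrC.
by apply => //; [lra|lra|exact: ltW].
Qed.

Lemma expR_add_opp_le x y : 0 <= x -> x <= y ->
  expR x + expR (- x) <= expR y + expR (- y).
Proof.
move=> x0 xy; rewrite -subr_ge0.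
have -> : expR y + expR (- y) - (expR x + expR (- x)) =
    (expR y - expR x) * (1 - expR (- x) * expR (- y)).
  rewrite !expRN; field.
  by rewrite !gt_eqF ?expR_gt0.
rewrite mulr_ge0// subr_ge0 ?ler_expR// -expRD -expR0 ler_expR; lra.
Qed.

(** This is the monotonicity of [sinh z / z], between [(2 - q) x] and [q x]. The derivative of the
    gap compares two hyperbolic cosines, in the right order because [2 - q <= q]. *)
Lemma expR_sub_opp_le q x : 1 <= q -> q <= 2 -> 0 <= x ->
  q * (expR ((2 - q) * x) - expR ((- (2 - q)) * x))
  <= (2 - q) * (expR (q * x) - expR ((- q) * x)).
Proof.
move=> q1 q2 x0; rewrite -subr_ge0.
pose k z : R := (2 - q) * (expR (q * z) - expR ((- q) * z))
  - q * (expR ((2 - q) * z) - expR ((- (2 - q)) * z)).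
have <- : k 0 = 0 by rewrite /k !mulr0 expR0; ring.
rewrite -/(k x).
apply: (@nondecreasing_by_derive _ k (fun z => (2 - q) * q *
  (expR (q * z) + expR (- (q * z)) - (expR ((2 - q) * z) + expR (- ((2 - q) * z)))))) => //.
- move=> z _; apply: is_derive_eqf.
  by rewrite /GRing.scale/= !mulr1 !mulNr; ring.
- move=> z /andP[z0 _]; rewrite mulr_ge0//; first by rewrite mulr_ge0; lra.
  by rewrite subr_ge0 expR_add_opp_le//; [apply: mulr_ge0; lra|apply: ler_wpM2r; lra].
Qed.

(** With [A] and [B] the differences of exponentials at [q u / 2, q v / 2] and at [al, be], the
    product on the right is [A ^ 2 - B ^ 2], and the sinh inequality around the common midpoint
    [q (u + v) / 4] gives [q B <= (2 - q) A]. The constant is [q ^ 2 - (2 - q) ^ 2 = 4 (q - 1)]. *)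
Let stroock_varopoulos_le q (u v : R) : 1 <= q -> q <= 2 -> v <= u ->
  4 * (q - 1) * (expR (q * u / 2) - expR (q * v / 2)) ^+ 2
  <= q ^+ 2 * ((expR u - expR v) * (expR ((q - 1) * u) - expR ((q - 1) * v))).
Proof.
move=> q1 q2 vu.
(* Half the exponents of the two cross terms of the product, so that these become the squares of
   [expR al] and [expR be]. *)
pose al := (u + (q - 1) * v) / 2; pose be := (v + (q - 1) * u) / 2.
have key : 0 <= q * (expR al - expR be) <= (2 - q) * (expR (q * u / 2) - expR (q * v / 2)).
  have -> : al = q * (u + v) / 4 + (2 - q) * ((u - v) / 4) by rewrite /al; lra.
  have -> : be = q * (u + v) / 4 + (- (2 - q)) * ((u - v) / 4) by rewrite /be; lra.
  have -> : q * u / 2 = q * (u + v) / 4 + q * ((u - v) / 4) by lra.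
  have -> : q * v / 2 = q * (u + v) / 4 + (- q) * ((u - v) / 4) by lra.
  rewrite !expRD -!mulrBr (mulrCA q (expR _)) (mulrCA (2 - q) (expR _)).
  rewrite ler_pM2l ?expR_gt0// pmulr_rge0 ?expR_gt0//.
  rewrite expR_sub_opp_le ?andbT//; last lra.
  by rewrite mulr_ge0//; [lra|rewrite subr_ge0 ler_expR; nra].
have := key => /andP[k0 k1].
have {k1} : (q * (expR al - expR be)) ^+ 2 <= ((2 - q) * (expR (q * u / 2) - expR (q * v / 2))) ^+ 2.
  by rewrite ler_sqr// nnegrE ?k0// (le_trans k0).
have E x : expR (x / 2) * expR (x / 2) = expR x.
  by rewrite -expRD; congr expR; lra.
have -> : (expR u - expR v) * (expR ((q - 1) * u) - expR ((q - 1) * v)) =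
   (expR (q * u / 2) - expR (q * v / 2)) ^+ 2 - (expR al - expR be) ^+ 2.
  have e1 : expR u * expR ((q - 1) * u) = expR (q * u / 2) * expR (q * u / 2).
    by rewrite E -expRD; congr expR; lra.
  have e2 : expR v * expR ((q - 1) * v) = expR (q * v / 2) * expR (q * v / 2).
    by rewrite E -expRD; congr expR; lra.
  have e3 : expR u * expR ((q - 1) * v) = expR al * expR al.
    by rewrite /al E -expRD.
  have e4 : expR v * expR ((q - 1) * u) = expR be * expR be.
    by rewrite /be E -expRD.
  have e5 : expR (q * u / 2) * expR (q * v / 2) = expR al * expR be.
    by rewrite -!expRD; congr expR; rewrite /al /be; lra.
  transitivity (expR u * expR ((q - 1) * u) + expR v * expR ((q - 1) * v)
    - expR u * expR ((q - 1) * v) - expR v * expR ((q - 1) * u)); first ring.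
  rewrite e1 e2 e3 e4.
  transitivity ((expR (q * u / 2)) ^+ 2 + expR (q * v / 2) ^+ 2 - 2 * (expR (q * u / 2) * expR (q * v / 2))
     - expR al ^+ 2 - expR be ^+ 2 + 2 * (expR al * expR be)); first by rewrite e5; ring.
  by ring.
set A := expR (q * u / 2) - _; set B := expR al - _ => h; nra.
Qed.

Lemma stroock_varopoulos q (u v : R) : 1 <= q -> q <= 2 ->
  4 * (q - 1) * (expR (q * u / 2) - expR (q * v / 2)) ^+ 2
  <= q ^+ 2 * ((expR u - expR v) * (expR ((q - 1) * u) - expR ((q - 1) * v))).
Proof.
move=> q1 q2; case: (leP v u) => [|/ltW] vu; first exact: stroock_varopoulos_le.
have := stroock_varopoulos_le q1 q2 vu.
set A := expR (q * u / 2); set B := expR (q * v / 2).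
have -> : (B - A) ^+ 2 = (A - B) ^+ 2 by ring.
by rewrite -[X in _ <= _ * X -> _]mulrNN !opprB.
Qed.

End two_point.

(** * From the logarithmic Sobolev inequality to hypercontractivity *)

Section gross.
Context {R : realType}.
Variables (p rh : R).
Hypothesis hp : 0 < p < 1.
Hypothesis rh0 : 0 < rh.
Hypothesis hrh : 2 / rh * (1 - p - p) = ln (1 - p) - ln p.
Hypothesis hrh1 : rh <= 1.

(** For [h] with values [al] and [be], apply the logarithmic Sobolev inequality to [h ^ (q / 2)],
    then Stroock-Varopoulos to replace its Dirichlet form by that of [h] against [h ^ (q - 1)],
    whose values are [A / al] and [B / be]. The latter form is what differentiating the L^q norm
    along the semigroup produces. *)
Let gross_step (q al be A B N : R) : 1 < q -> q <= 2 -> 0 < al -> 0 < be ->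
  A = expR (q * ln al) -> B = expR (q * ln be) -> N = p * A + (1 - p) * B ->
  2 * rh * (q - 1) * (p * A * (q * ln al) + (1 - p) * B * (q * ln be) - N * ln N)
  <= q ^+ 2 * (p * (1 - p) * (al - be) * (A / al - B / be)).
Proof.
move=> q1 q2 al0 be0 AE BE NE; have /andP[p0 p1] := hp.
pose x := expR (q * ln al / 2); pose y := expR (q * ln be / 2).
have xA : x ^+ 2 = A by rewrite AE expr2 -expRD; congr expR; lra.
have yB : y ^+ 2 = B by rewrite BE expr2 -expRD; congr expR; lra.
have hc2 : 2 <= 2 / rh by rewrite ler_pdivlMr// ler_piMr.
have := @two_point_log_sobolev R p (2 / rh) x y hp hrh hc2 (expR_gt0 _) (expR_gt0 _).
have lnA : ln A = q * ln al by rewrite AE expRK.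
have lnB : ln B = q * ln be by rewrite BE expRK.
rewrite xA yB -NE lnA lnB => lsi.
have := @stroock_varopoulos R q (ln al) (ln be) (ltW q1) q2.
rewrite !lnK ?posrE// -/x -/y.
have -> : expR ((q - 1) * ln al) = A / al.
  by rewrite mulrBl mul1r expRB lnK -?AE -?BE.
have -> : expR ((q - 1) * ln be) = B / be.
  by rewrite mulrBl mul1r expRB lnK -?AE -?BE.
move=> sv.
apply: (@le_trans _ _ (2 * rh * (q - 1) * (2 / rh * (p * (1 - p)) * (x - y) ^+ 2))).
  by rewrite ler_pM2l// !mulr_gt0//; lra.
have -> : 2 * rh * (q - 1) * (2 / rh * (p * (1 - p)) * (x - y) ^+ 2) =
  p * (1 - p) * (4 * (q - 1) * (x - y) ^+ 2) by field; rewrite gt_eqF.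
have -> : q ^+ 2 * (p * (1 - p) * (al - be) * (A / al - B / be)) =
  p * (1 - p) * (q ^+ 2 * ((al - be) * (A / al - B / be))) by ring.
by rewrite ler_pM2l// mulr_gt0//; lra.
Qed.

(* Gross's argument: [ln ||P_s h||_{q(s)}] is nonincreasing along
   [q(s) = 1 + exp (2 rh (s - S))], which ends at exponent 2. *)
Let two_point_hypercontractive_gt0 (t a b : R) : 0 < t -> 0 < a -> 0 < b ->
  ((p * a + (1 - p) * b) ^+ 2 + expR (- t) * (p * (1 - p) * (a - b) ^+ 2))
    `^ ((1 + expR (- (rh * t))) / 2)
  <= p * a `^ (1 + expR (- (rh * t))) + (1 - p) * b `^ (1 + expR (- (rh * t))).
Proof.
move=> t0 a0 b0; have /andP[p0 p1] := hp.
set m := p * a + (1 - p) * b.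
have m0 : 0 < m by rewrite /m; nra.
pose S := t / 2.
pose q (s : R) : R := 1 + expR (2 * rh * (s - S)).
(* [al s] and [be s] are the two values of [P_s h], which shrinks the deviations from the mean [m]
   by [exp (- s)]. At [S = t / 2] the squared L^2 norm has the factor [exp (- t)] of the claim. *)
pose al (s : R) : R := m + expR (- 1 * s) * (a - m).
pose be (s : R) : R := m + expR (- 1 * s) * (b - m).
pose N (s : R) : R := p * expR (q s * ln (al s)) + (1 - p) * expR (q s * ln (be s)).
pose Phi (s : R) : R := ln (N s) * (q s)^-1.
have q1 s : 1 < q s by rewrite /q ltrDl expR_gt0.
have q2 s : s <= S -> q s <= 2.
  move=> sS; rewrite /q -lerBrDl (_ : 2 - 1 = 1 :> R); last lra.
  by rewrite -expR0 ler_expR mulr_ge0_le0 ?subr_le0// mulr_ge0// ltW.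
have e01 s : 0 <= s -> 0 < expR (- 1 * s) <= 1.
  by move=> s0; rewrite expR_gt0/= -[X in _ <= X]expR0 ler_expR; lra.
have al0 s : 0 <= s -> 0 < al s.
  move=> /e01/andP[]; rewrite /al; set e := expR _ => e0 e1.
  have -> : m + e * (a - m) = (1 - e) * m + e * a by ring.
  by nra.
have be0 s : 0 <= s -> 0 < be s.
  move=> /e01/andP[]; rewrite /be; set e := expR _ => e0 e1.
  have -> : m + e * (b - m) = (1 - e) * m + e * b by ring.
  by nra.
have N0 s : 0 < N s by rewrite addr_gt0// mulr_gt0 ?expR_gt0//; lra.
pose dq (s : R) : R := 2 * rh * (q s - 1).
have derq (s : R) : is_derive s 1 q (dq s).
  eapply is_derive_eqf; first by rewrite /q; repeat derive.
  by rewrite /dq /q; ring.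
have deral (s : R) : is_derive s 1 al (- (al s - m)).
  eapply is_derive_eqf; first by rewrite /al; repeat derive.
  by rewrite /al; ring.
have derbe (s : R) : is_derive s 1 be (- (be s - m)).
  eapply is_derive_eqf; first by rewrite /be; repeat derive.
  by rewrite /be; ring.
pose dN (s : R) : R :=
   p * (expR (q s * ln (al s)) * (q s * ((al s)^-1 * - (al s - m)) + ln (al s) * dq s))
 + (1 - p) * (expR (q s * ln (be s)) * (q s * ((be s)^-1 * - (be s - m)) + ln (be s) * dq s)).
have derN (s : R) : 0 <= s -> is_derive s 1 N (dN s).
  move=> s0.
  have dA := is_derive_expf (is_derive_mulf (derq s) (is_derive_lnf (al0 s s0) (deral s))).
  have dB := is_derive_expf (is_derive_mulf (derq s) (is_derive_lnf (be0 s s0) (derbe s))).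
  refine (is_derive_eqf (is_derive_addf (is_derive_mulf (is_derive_constf p s) dA)
    (is_derive_mulf (is_derive_constf (1 - p) s) dB)) _).
  by rewrite /dN !mulr0 !addr0.
have derPhi (s : R) : 0 <= s -> is_derive s 1 Phi
    (ln (N s) * (- (q s) ^- 2 * dq s) + (q s)^-1 * ((N s)^-1 * dN s)).
  move=> s0; have qs : q s != 0 by rewrite gt_eqF// (lt_trans ltr01).
  exact (is_derive_mulf (is_derive_lnf (N0 s) (derN s s0)) (is_derive_invf qs (derq s))).
have S0 : 0 <= S by rewrite /S; lra.
have Phi_le : Phi S <= Phi 0.
  apply: (nonincreasing_by_derive S0 (fun s hs => derPhi s _)) => [x /andP[]//|s /andP[s0 sS]].
  have := gross_step (q1 s) (q2 s sS) (al0 s s0) (be0 s s0) erefl erefl erefl.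
  rewrite -/(N s) => gs.
  have als : al s != 0 by rewrite gt_eqF ?al0.
  have bes : be s != 0 by rewrite gt_eqF ?be0.
  have qs : q s != 0 by rewrite gt_eqF// (lt_trans ltr01).
  have Ns : N s != 0 by rewrite gt_eqF.
  (* The semigroup keeps the mean; replacing [m] by this average makes [al s - m] a multiple of
     [al s - be s], which brings out the Dirichlet form of [gross_step]. *)
  have mE : p * al s + (1 - p) * be s = m by rewrite /al /be /m; ring.
  have -> : ln (N s) * (- (q s) ^- 2 * dq s) + (q s)^-1 * ((N s)^-1 * dN s) =
   (q s ^+ 2 * N s)^-1 *
    (2 * rh * (q s - 1) * (p * expR (q s * ln (al s)) * (q s * ln (al s)) +
       (1 - p) * expR (q s * ln (be s)) * (q s * ln (be s)) - N s * ln (N s))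
     - q s ^+ 2 * (p * (1 - p) * (al s - be s) *
        (expR (q s * ln (al s)) / al s - expR (q s * ln (be s)) / be s))).
    rewrite /dN /dq -mE; field; by rewrite als bes qs Ns.
  rewrite mulr_ge0_le0//; last by rewrite subr_le0.
  by rewrite invr_ge0 mulr_ge0 ?sqr_ge0 ?ltW.
move: Phi_le; rewrite /Phi.
have qS : q S = 2 by rewrite /q subrr mulr0 expR0; lra.
have q0 : q 0 = 1 + expR (- (rh * t)).
  by rewrite /q /S; congr (_ + expR _); lra.
have alb0 : al 0 = a by rewrite /al mulr0 expR0; ring.
have beb0 : be 0 = b by rewrite /be mulr0 expR0; ring.
have sqE x : 0 < x -> expR (2 * ln x) = x ^+ 2.
  by move=> x0; rewrite expRM_natl lnK.
have NS : N S = m ^+ 2 + expR (- t) * (p * (1 - p) * (a - b) ^+ 2).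
  rewrite /N qS !sqE ?al0 ?be0//.
  have -> : expR (- t) = expR (- 1 * S) ^+ 2.
    by rewrite -expRM_natl /S; congr expR; lra.
  by rewrite /al /be /m; ring.
have N0E : N 0 = p * a `^ (1 + expR (- (rh * t))) + (1 - p) * b `^ (1 + expR (- (rh * t))).
  by rewrite /N alb0 beb0 q0 /powR !gt_eqF.
rewrite -N0E -NS qS -q0.
rewrite ler_pdivlMr ?(lt_trans ltr01)// => h.
rewrite /powR gt_eqF// -[leRHS](lnK) ?posrE// ler_expR.
by rewrite (_ : q 0 / 2 * ln (N S) = ln (N S) * 2^-1 * q 0)//; ring.
Qed.

(* The left-hand side increases with [a] and [b], so a vanishing argument can be
   replaced by [e], at a cost of at most [e] on the right. *)
Lemma two_point_hypercontractive (t a b : R) : 0 < t -> 0 <= a -> 0 <= b ->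
  ((p * a + (1 - p) * b) ^+ 2 + expR (- t) * (p * (1 - p) * (a - b) ^+ 2))
    `^ ((1 + expR (- (rh * t))) / 2)
  <= p * a `^ (1 + expR (- (rh * t))) + (1 - p) * b `^ (1 + expR (- (rh * t))).
Proof.
move=> t0 a0 b0; have /andP[p0 p1] := hp; set q := 1 + expR _.
have q1 : 1 <= q by rewrite /q lerDl expR_ge0.
have r01 : 0 < expR (- t) <= 1 by rewrite expR_gt0/= -expR0 ler_expR; lra.
pose lhs (x y : R) : R := (p * x + (1 - p) * y) ^+ 2 + expR (- t) * (p * (1 - p) * (x - y) ^+ 2).
have lhs0 x y : 0 <= lhs x y.
  apply: addr_ge0; first exact: sqr_ge0.
  apply: mulr_ge0; first exact: expR_ge0.
  by apply: mulr_ge0; [apply: mulr_ge0; lra|exact: sqr_ge0].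
(* A nonnegative combination of the squared mean and the second moment, hence monotone in
   nonnegative [x] and [y]. *)
have lhsE x y : lhs x y = (1 - expR (- t)) * (p * x + (1 - p) * y) ^+ 2
    + expR (- t) * (p * x ^+ 2 + (1 - p) * y ^+ 2) by rewrite /lhs; ring.
have lhs_le x y x' y' : 0 <= x -> 0 <= y -> x <= x' -> y <= y' -> lhs x y <= lhs x' y'.
  move=> x0 y0 xx yy; rewrite !lhsE; apply: lerD; (apply: ler_wpM2l; first lra).
    by rewrite ler_sqr ?nnegrE; nra.
  have xx2 : x ^+ 2 <= x' ^+ 2 by nra.
  have yy2 : y ^+ 2 <= y' ^+ 2 by nra.
  by apply: lerD; apply: ler_wpM2l => //; lra.
have pos (x e : R) : 0 <= x -> 0 < e <= 1 -> exists2 y, 0 < y & x <= y /\ y `^ q <= x `^ q + e.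
  rewrite le_eqVlt => /orP[/eqP<-|x0] /andP[e0 e1]; last first.
    by exists x => //; split=> //; rewrite lerDl ltW.
  exists e => //; split; first exact: ltW.
  by rewrite powR0 ?add0r ?ge1r_powR ?e0// gt_eqF// (lt_le_trans ltr01).
apply/ler_addgt0Pr => e e0.
pose e' := Num.min e 1.
have e'0 : 0 < e' <= 1 by rewrite /e' lt_min e0 ltr01 ge_min lexx orbT.
have [a' a'0 [aa' ha]] := pos a e' a0 e'0.
have [b' b'0 [bb' hb]] := pos b e' b0 e'0.
apply: (@le_trans _ _ (lhs a' b' `^ (q / 2))).
  by apply: ge0_ler_powR; rewrite ?nnegrE ?lhs0 ?lhs_le//; lra.
apply: (le_trans (two_point_hypercontractive_gt0 t0 a'0 b'0)); rewrite -/q.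
have e'e : e' <= e by rewrite ge_min lexx.
by nra.
Qed.

(** The left-hand side is the inner product of two functions smoothed over time [t / 2]. The
    Cauchy-Schwarz inequality, here an explicit Lagrange identity, bounds it by the two L^2 norms,
    and each of these by an L^q norm. *)
Lemma two_point_hypercontractive_bilinear (t a b c d : R) : 0 < t ->
  0 <= a -> 0 <= b -> 0 <= c -> 0 <= d ->
  expR (- t) * (p * (a * c) + (1 - p) * (b * d))
    + (1 - expR (- t)) * ((p * a + (1 - p) * b) * (p * c + (1 - p) * d))
  <= (p * a `^ (1 + expR (- (rh * t))) + (1 - p) * b `^ (1 + expR (- (rh * t))))
       `^ (1 + expR (- (rh * t)))^-1
     * (p * c `^ (1 + expR (- (rh * t))) + (1 - p) * d `^ (1 + expR (- (rh * t))))
       `^ (1 + expR (- (rh * t)))^-1.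
Proof.
move=> t0 a0 b0 c0 d0; have /andP[p0 p1] := hp.
have := two_point_hypercontractive t0 c0 d0; have := two_point_hypercontractive t0 a0 b0.
set q := 1 + expR _; set r := expR (- t).
have q1 : 1 <= q by rewrite /q lerDl expR_ge0.
set U := p * a `^ q + _; set V := p * c `^ q + _; 
pose u := (p * a + (1 - p) * b) ^+ 2 + r * (p * (1 - p) * (a - b) ^+ 2).
pose v := (p * c + (1 - p) * d) ^+ 2 + r * (p * (1 - p) * (c - d) ^+ 2).
rewrite -/u -/v => hu hv.
have r0 : 0 < r by exact: expR_gt0.
have u0 : 0 <= u.
  apply: addr_ge0; first exact: sqr_ge0.
  apply: mulr_ge0; first exact: expR_ge0.
  by apply: mulr_ge0; [apply: mulr_ge0; lra|exact: sqr_ge0].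
have v0 : 0 <= v.
  apply: addr_ge0; first exact: sqr_ge0.
  apply: mulr_ge0; first exact: expR_ge0.
  by apply: mulr_ge0; [apply: mulr_ge0; lra|exact: sqr_ge0].
have U0 : 0 <= U by rewrite addr_ge0// mulr_ge0 ?powR_ge0//; lra.
have V0 : 0 <= V by rewrite addr_ge0// mulr_ge0 ?powR_ge0//; lra.
have root x y : 0 <= x -> 0 <= y -> x `^ (q / 2) <= y -> Num.sqrt x <= y `^ q^-1.
  move=> x0 y0 h; rewrite -powR12_sqrt//.
  have -> : (2^-1 : R) = q / 2 * q^-1 by field; lra.
  by rewrite powRrM ge0_ler_powR ?nnegrE ?powR_ge0//; rewrite invr_ge0; lra.
apply: (@le_trans _ _ (Num.sqrt u * Num.sqrt v)); last first.
  by rewrite ler_pM ?sqrtr_ge0 ?root.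
rewrite -sqrtrM// (le_trans (ler_norm _))// -sqrtr_sqr ler_wsqrtr//.
have -> : u * v = (r * (p * (a * c) + (1 - p) * (b * d)) +
  (1 - r) * ((p * a + (1 - p) * b) * (p * c + (1 - p) * d))) ^+ 2
  + r * (p * (1 - p)) * ((a - b) * (p * c + (1 - p) * d) - (c - d) * (p * a + (1 - p) * b)) ^+ 2.
  by rewrite /u /v; ring.
by rewrite lerDl mulr_ge0 ?sqr_ge0// !mulr_ge0//; lra.
Qed.

End gross.

(** * The rate [rho] and the exponent [theta] *)

Section rho_theory.
Context {R : realType}.
Variable p : R.
Hypothesis hp : 0 < p < 1.

(** The logit minus its tangent at 1/2 is nondecreasing. Its sign on either side of 1/2 settles both
    the positivity of [rho] and the bound [rho <= 1]. *)
Let logit_derive (x : R) : 0 < x < 1 ->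
  is_derive x 1 (fun z => ln z - ln (1 - z) - 2 * (2 * z - 1)) (x^-1 + (1 - x)^-1 - 4).
Proof.
move=> /andP[x0 x1]; eapply is_derive_eqf; first by repeat derive; lra.
by rewrite /=; field; lra.
Qed.

Let logit_derive_ge0 (x : R) : 0 < x < 1 -> 0 <= x^-1 + (1 - x)^-1 - 4.
Proof.
move=> /andP[x0 x1].
have -> : x^-1 + (1 - x)^-1 - 4 = (2 * x - 1) ^+ 2 / (x * (1 - x)) by field; lra.
by rewrite divr_ge0 ?sqr_ge0// mulr_ge0//; lra.
Qed.

Let logit_half : ln 2^-1 - ln (1 - 2^-1) - 2 * (2 * 2^-1 - 1) = 0 :> R.
Proof. by rewrite (_ : 1 - 2^-1 = 2^-1 :> R); lra. Qed.

Let half_gt0 : 0 < 2^-1 :> R. Proof. by rewrite invr_gt0. Qed.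
Let half_lt1 : 2^-1 < 1 :> R. Proof. by rewrite invf_lt1 ?ltr1n. Qed.

Let logit_ge : 2^-1 <= p -> 2 * (2 * p - 1) <= ln p - ln (1 - p).
Proof.
move=> h; rewrite -subr_ge0 -logit_half.
apply: (nondecreasing_by_derive h (fun x hx => logit_derive _)) => x /andP[hx xp]; [|apply: logit_derive_ge0];
  by rewrite (lt_le_trans half_gt0)//= (le_lt_trans xp) ?(andP hp).2.
Qed.

Let logit_le : p <= 2^-1 -> ln p - ln (1 - p) <= 2 * (2 * p - 1).
Proof.
move=> h; rewrite -subr_le0 -logit_half.
apply: (nondecreasing_by_derive h (fun x hx => logit_derive _)) => x /andP[px xh]; [|apply: logit_derive_ge0];
  by rewrite (lt_le_trans (andP hp).1)//= (le_lt_trans xh).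
Qed.

Lemma rho_gt0 : 0 < rho p.
Proof.
rewrite /rho; case: eqVneq => // hp2.
case: (ltgtP p 2^-1) hp2 => // h _.
  by rewrite -mulrNN -invrN mulr_gt0 ?invr_gt0// ?oppr_gt0; have := logit_le (ltW h); lra.
by rewrite divr_gt0//; have := logit_ge (ltW h); lra.
Qed.

Lemma rho_le1 : rho p <= 1.
Proof.
rewrite /rho; case: eqVneq => // hp2.
case: (ltgtP p 2^-1) hp2 => // h _.
  have := logit_le (ltW h) => h'; rewrite -mulrNN -invrN ler_pdivrMr; lra.
by have := logit_ge (ltW h) => h'; rewrite ler_pdivrMr; lra.
Qed.

(** Identifies [2 / rho p] with the logarithmic Sobolev constant. The product form also makes sense
    at [p = 1/2], where both sides vanish. *)
Lemma rho_logit : 2 / rho p * (1 - p - p) = ln (1 - p) - ln p.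
Proof.
rewrite /rho; case: eqVneq => [->|hp2].
  by rewrite (_ : 1 - 2^-1 = 2^-1 :> R); lra.
have : ln p - ln (1 - p) != 0.
  case: (ltgtP p 2^-1) hp2 => // h _.
    by rewrite lt_eqF//; have := logit_le (ltW h); lra.
  by rewrite gt_eqF//; have := logit_ge (ltW h); lra.
move=> l0; field; rewrite l0/=.
by apply: contra_neq hp2 => h; lra.
Qed.

(** With [q = 1 + expR (- (rho p * t))] the right-hand side is the interpolation exponent
    [(2 - q) / q]. *)
Lemma theta_expR (t : R) : theta p t = (1 - expR (- (rho p * t))) / (1 + expR (- (rho p * t))).
Proof.
rewrite /theta /tanh; set x := rho p * t / 2.
have -> : - (rho p * t) = - x - x by rewrite /x; lra.
rewrite expRD !expRN; field.
have := expR_gt0 x; have := sqr_ge0 (expR x); set e := expR x => h1 h2.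
by rewrite !gt_eqF//; nra.
Qed.

Lemma theta_gt0 (t : R) : 0 < t -> 0 < theta p t.
Proof.
move=> t0; have r0 := rho_gt0; rewrite theta_expR divr_gt0//.
  by rewrite subr_gt0 -[ltRHS]expR0 ltr_expR oppr_lt0 mulr_gt0.
Qed.

End rho_theory.

(** * Functions of finitely many bits *)

Lemma powR_hoelder2 (R : realType) (th a b c d : R) : 0 < th < 1 -> 0 <= a -> 0 <= b -> 0 <= c -> 0 <= d ->
  a `^ th * b `^ (1 - th) + c `^ th * d `^ (1 - th) <= (a + c) `^ th * (b + d) `^ (1 - th).
Proof.
move=> /andP[t0 t1] a0 b0 c0 d0.
have t1' : 0 < 1 - th by rewrite subr_gt0.
have := @hoelder2 R (a `^ th) (c `^ th) (b `^ (1 - th)) (d `^ (1 - th)) th^-1 (1 - th)^-1.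
rewrite -!powRrM !divff ?gt_eqF// !powRr1// !invrK; apply; rewrite ?powR_ge0 ?invr_gt0//.
by ring.
Qed.

Lemma sqrt_add_le (R : realType) (x y z w : R) : 0 <= x -> 0 <= y -> 0 <= z -> 0 <= w ->
  Num.sqrt (x * y) + Num.sqrt (z * w) <= Num.sqrt ((x + z) * (y + w)).
Proof.
move=> x0 y0 z0 w0.
rewrite -[leLHS]ger0_norm ?addr_ge0 ?sqrtr_ge0// -sqrtr_sqr ler_wsqrtr//.
rewrite sqrrD !sqr_sqrtr ?mulr_ge0//.
have h : 2 * Num.sqrt (x * y) * Num.sqrt (z * w) <= x * w + z * y.
  rewrite -mulrA -sqrtrM ?mulr_ge0//.
  have -> : x * y * (z * w) = (x * w) * (z * y) by ring.
  rewrite sqrtrM ?mulr_ge0//.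
  have := sqr_ge0 (Num.sqrt (x * w) - Num.sqrt (z * y)).
  by rewrite sqrrB !sqr_sqrtr ?mulr_ge0//; lra.
by rewrite -mulr_natl mulrA; lra.
Qed.

Section cube.
Context {R : realType}.
Implicit Types (n i : nat) (F G : seq bool -> R).

(* Expectation under the product Bernoulli measure; only the values of [F] on
   sequences of length [n] matter. *)
Fixpoint cubeE (p : R) n F : R :=
  if n is n'.+1 then p * cubeE p n' (fun s => F (true :: s))
                     + (1 - p) * cubeE p n' (fun s => F (false :: s))
  else F [::].

(* [E [F x * G y]] for product Bernoulli [x] and [y], where each bit of [y] is
   that of [x] with probability [r] and is resampled otherwise. *)
Fixpoint cubeT (p r : R) n F G : R :=
  if n is n'.+1 then
    let T a b := cubeT p r n' (fun s => F (a :: s)) (fun s => G (b :: s)) in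
    r * (p * T true true + (1 - p) * T false false)
    + (1 - r) * (p * (p * T true true + (1 - p) * T true false)
                 + (1 - p) * (p * T false true + (1 - p) * T false false))
  else F [::] * G [::].

(** The conditional expectation of [F] given all bits but the [i]-th. *)
Definition resample (p : R) i F (s : seq bool) : R :=
  p * F (set_nth false s i true) + (1 - p) * F (set_nth false s i false).

Definition cube_inf (p : R) n i F : R := cubeE p n (fun s => `|F s - resample p i F s|).

Definition cube_var (p : R) n F : R := cubeE p n (fun s => F s ^+ 2) - cubeE p n F ^+ 2.

Lemma cubeE_lin p n (a b : R) F G :
  cubeE p n (fun s => a * F s + b * G s) = a * cubeE p n F + b * cubeE p n G.
Proof. by elim: n F G => [//|n IHn] F G /=; rewrite !IHn; ring. Qed.

Lemma cubeE_eq p n F G : F =1 G -> cubeE p n F = cubeE p n G.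
Proof. by move=> FG; congr cubeE; apply/funext. Qed.

Lemma cubeT_linl p r n (a b : R) F F' G :
  cubeT p r n (fun s => a * F s + b * F' s) G = a * cubeT p r n F G + b * cubeT p r n F' G.
Proof. by elim: n F F' G => [|n IHn] F F' G /=; rewrite ?IHn; ring. Qed.

Lemma cubeT_linr p r n (a b : R) F G G' :
  cubeT p r n F (fun s => a * G s + b * G' s) = a * cubeT p r n F G + b * cubeT p r n F G'.
Proof. by elim: n F G G' => [|n IHn] F G G' /=; rewrite ?IHn; ring. Qed.

Section bounded.
Variable p : R.
Hypothesis hp : 0 < p < 1.
Let p0 : 0 < p. Proof. by case/andP: hp. Qed.
Let q0 : 0 < 1 - p. Proof. by case/andP: hp => _ h; rewrite subr_gt0. Qed.

Lemma cubeE_le n F G : (forall s, F s <= G s) -> cubeE p n F <= cubeE p n G.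
Proof.
elim: n F G => [|n IHn] F G FG /=; first exact: FG.
by rewrite lerD// ler_pM2l// IHn.
Qed.

Lemma cubeE_ge0 n F : (forall s, 0 <= F s) -> 0 <= cubeE p n F.
Proof.
elim: n F => [|n IHn] F F0 /=; first exact: F0.
by rewrite addr_ge0// mulr_ge0 ?IHn// ltW.
Qed.

Lemma cube_inf_ge0 n i F : 0 <= cube_inf p n i F.
Proof. by apply: cubeE_ge0 => s; rewrite normr_ge0. Qed.

Lemma cubeE_sqr_le n F : cubeE p n F ^+ 2 <= cubeE p n (fun s => F s ^+ 2).
Proof.
elim: n F => [//|n IHn] F /=.
apply: (@le_trans _ _ (p * cubeE p n (fun s => F (true :: s)) ^+ 2
   + (1 - p) * cubeE p n (fun s => F (false :: s)) ^+ 2)); last by rewrite lerD// ler_pM2l// IHn.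
rewrite -subr_ge0; set a := cubeE _ _ _; set b := cubeE _ _ _.
have -> : p * a ^+ 2 + (1 - p) * b ^+ 2 - (p * a + (1 - p) * b) ^+ 2 = p * (1 - p) * (a - b) ^+ 2 by ring.
by rewrite mulr_ge0 ?sqr_ge0// mulr_ge0 ?ltW.
Qed.

Lemma cube_var_ge0 n F : 0 <= cube_var p n F.
Proof. by rewrite subr_ge0 cubeE_sqr_le. Qed.

Lemma cubeT_le_norm r n F G : 0 <= r <= 1 ->
  cubeT p r n F G <= cubeT p r n (fun s => `|F s|) (fun s => `|G s|).
Proof.
move=> /andP[r0 r1]; elim: n F G => [|n IHn] F G /=; first by rewrite -normrM ler_norm.
have r1' : 0 <= 1 - r by rewrite subr_ge0.
by repeat (apply: lerD || (apply: ler_wpM2l; [exact: ltW || done|]) || exact: IHn).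
Qed.

(** Each bit costs one two-term Hoelder inequality, after [wsplit] has shared the weight of a branch
    between the two factors. *)
Lemma cubeE_hoelder (th : R) n F G : 0 < th < 1 -> (forall s, 0 <= F s) -> (forall s, 0 <= G s) ->
  cubeE p n (fun s => F s `^ th * G s `^ (1 - th)) <= cubeE p n F `^ th * cubeE p n G `^ (1 - th).
Proof.
move=> hth; elim: n F G => [//|n IHn] F G F0 G0 /=.
have wsplit (w x y : R) : 0 < w -> 0 <= x -> 0 <= y ->
    w * (x `^ th * y `^ (1 - th)) = (w * x) `^ th * (w * y) `^ (1 - th).
  move=> w0 x0 y0; rewrite !powRM ?(ltW w0)// mulrACA -powRD; last first.
    by rewrite addrCA subrr addr0 oner_eq0.
  by rewrite addrCA subrr addr0 powRr1// ltW.
apply: (le_trans _ (powR_hoelder2 hth _ _ _ _)); try by rewrite mulr_ge0 ?cubeE_ge0// ltW.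
by rewrite -!wsplit ?cubeE_ge0// lerD// ler_pM2l// IHn.
Qed.

(** Hoelder's inequality for the splitting [q = (2 - q) * 1 + (q - 1) * 2], followed by a [q]-th
    root. *)
Lemma cubeE_lyapunov (q : R) n F : 1 < q < 2 -> (forall s, 0 <= F s) ->
  (cubeE p n (fun s => F s `^ q)) `^ q^-1
  <= (cubeE p n F) `^ ((2 - q) / q) * (cubeE p n (fun s => F s ^+ 2)) `^ ((1 - (2 - q) / q) / 2).
Proof.
move=> /andP[q1 q2] F0.
have hth : 0 < 2 - q < 1 by lra.
have q'0 : 0 < q by lra.
have := @cubeE_hoelder (2 - q) n F (fun s => F s ^+ 2) hth F0 (fun s => sqr_ge0 _).
rewrite (@cubeE_eq p n (fun s => F s `^ (2 - q) * (F s ^+ 2) `^ (1 - (2 - q))) (fun s => F s `^ q)); last first.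
  move=> s; rewrite -powR_mulrn// -powRrM -powRD; last by apply/implyP => /eqP; lra.
  by congr (_ `^ _); ring.
have E0 : 0 <= cubeE p n F by exact: cubeE_ge0.
have E2 : 0 <= cubeE p n (fun s => F s ^+ 2) by apply: cubeE_ge0 => s; exact: sqr_ge0.
have Eq : 0 <= cubeE p n (fun s => F s `^ q) by apply: cubeE_ge0 => s; exact: powR_ge0.
move=> h; apply: (@le_trans _ _ ((cubeE p n F `^ (2 - q) * cubeE p n (fun s => F s ^+ 2) `^ (1 - (2 - q))) `^ q^-1)).
  by apply: ge0_ler_powR => //; rewrite ?nnegrE ?mulr_ge0 ?powR_ge0// invr_ge0 ltW.
rewrite powRM ?powR_ge0// -!powRrM.
have -> : (1 - (2 - q) / q) / 2 = (1 - (2 - q)) / q by field; lra.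
exact: lexx.
Qed.

Section noise.
Variables (r q : R).
Hypothesis hr : 0 <= r <= 1.
Hypothesis hq : 1 < q < 2.
Hypothesis two_point : forall a b c d : R, 0 <= a -> 0 <= b -> 0 <= c -> 0 <= d ->
  r * (p * (a * c) + (1 - p) * (b * d))
    + (1 - r) * ((p * a + (1 - p) * b) * (p * c + (1 - p) * d))
  <= (p * a `^ q + (1 - p) * b `^ q) `^ q^-1 * (p * c `^ q + (1 - p) * d `^ q) `^ q^-1.

Let th := (2 - q) / q.

(** Tensorization: fixing the first bits, the induction hypothesis bounds each pair of slices by the
    product of their L^q norms [u a * v b]; the two-point inequality then applies to [u] and [v] as
    functions of one bit. *)
Lemma cubeT_hypercontractive n F G : (forall s, 0 <= F s) -> (forall s, 0 <= G s) ->
  cubeT p r n F G <= cubeE p n (fun s => F s `^ q) `^ q^-1 * cubeE p n (fun s => G s `^ q) `^ q^-1.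
Proof.
have /andP[q1 q2] := hq; have q'0 : 0 < q by lra.
have [r0 r1] := andP hr; have r1' : 0 <= 1 - r by rewrite subr_ge0.
have root (x : R) : 0 <= x -> (x `^ q^-1) `^ q = x.
  by move=> x0; rewrite -powRrM mulVf ?gt_eqF// powRr1.
elim: n F G => [|n IHn] F G F0 G0 /=.
  by rewrite -!powRrM divff ?gt_eqF// !powRr1.
have [u hu] : exists u : bool -> R,
    forall b, u b = cubeE p n (fun s => F (b :: s) `^ q) `^ q^-1.
  by exists (fun b => cubeE p n (fun s => F (b :: s) `^ q) `^ q^-1).
have [v hv] : exists v : bool -> R,
    forall b, v b = cubeE p n (fun s => G (b :: s) `^ q) `^ q^-1.
  by exists (fun b => cubeE p n (fun s => G (b :: s) `^ q) `^ q^-1).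
have u0 b : 0 <= u b by rewrite hu powR_ge0.
have v0 b : 0 <= v b by rewrite hv powR_ge0.
have uq b : cubeE p n (fun s => F (b :: s) `^ q) = u b `^ q.
  by rewrite hu root//; apply: cubeE_ge0 => s; exact: powR_ge0.
have vq b : cubeE p n (fun s => G (b :: s) `^ q) = v b `^ q.
  by rewrite hv root//; apply: cubeE_ge0 => s; exact: powR_ge0.
have IH a b : cubeT p r n (fun s => F (a :: s)) (fun s => G (b :: s)) <= u a * v b.
  by rewrite hu hv; exact: IHn.
rewrite (uq true) (uq false) (vq true) (vq false).
apply: le_trans (two_point (u0 true) (u0 false) (v0 true) (v0 false)).
have -> : (p * u true + (1 - p) * u false) * (p * v true + (1 - p) * v false) =
  p * (p * (u true * v true) + (1 - p) * (u true * v false)) +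
  (1 - p) * (p * (u false * v true) + (1 - p) * (u false * v false)) by ring.
by repeat (apply: lerD || (apply: ler_wpM2l; [exact: ltW || done|]) || exact: IH).
Qed.

Lemma cube_covariance_le n F G :
  cubeT p r n F G - cubeE p n F * cubeE p n G
  <= Num.sqrt (cube_var p n F * cube_var p n G) `^ (1 - th)
     * (\sum_(i < n) cube_inf p n i F * cube_inf p n i G) `^ th.
Proof.
have /andP[q1 q2] := hq; have q'0 : 0 < q by lra.
have hth : 0 < th < 1.
  by rewrite /th ltr_pdivrMr// mul1r divr_gt0//=; lra.
elim: n F G => [|n IHn] F G; first by rewrite /= subrr mulr_ge0 ?powR_ge0.
(* [av F] averages out the first bit; [de F], the deviation from that average, is the first
   martingale difference. *)
pose av F (s : seq bool) : R := p * F (true :: s) + (1 - p) * F (false :: s).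
pose de F (s : seq bool) : R := F s - resample p 0 F s.
have deE F' b s : de F' (b :: s) = (if b then 1 - p else - p) * (F' (true :: s)) + (if b then - (1 - p) else p) * F' (false :: s).
  by rewrite /de /resample /=; case: b; ring.
(* No mixed term survives: [av] ignores the first bit, over which [de] has mean 0, and the noise
   acts on each bit separately. *)
have Tsplit : cubeT p r n.+1 F G = cubeT p r n.+1 (de F) (de G) + cubeT p r n (av F) (av G).
  rewrite /= /av.
  under [fun s => de F (true :: s)]funext do rewrite deE.
  under [fun s => de F (false :: s)]funext do rewrite deE.
  under [fun s => de G (true :: s)]funext do rewrite deE.
  under [fun s => de G (false :: s)]funext do rewrite deE.
  rewrite !cubeT_linl !cubeT_linr; ring.
have Eav F' : cubeE p n.+1 F' = cubeE p n (av F') by rewrite /av cubeE_lin.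
have Vsplit F' : cube_var p n.+1 F' = cubeE p n.+1 (fun s => `|de F' s| ^+ 2) + cube_var p n (av F').
  rewrite /cube_var [X in _ - X ^+ 2 = _]Eav addrA; congr (_ - _).
  rewrite /= -!cubeE_lin -[X in _ = X + _]mul1r -[X in _ = _ + X]mul1r -cubeE_lin.
  by apply: cubeE_eq => s; rewrite !real_normK ?num_real// !deE /av; ring.
(* Averaging only lowers the other influences, so differences taken after earlier bits are averaged
   out remain bounded by influences of the original function. *)
have inf_av i F' : cube_inf p n i (av F') <= cube_inf p n.+1 i.+1 F'.
  rewrite /cube_inf /= -cubeE_lin; apply: cubeE_le => s.
  have -> : av F' s - resample p i (av F') s =
      p * (F' (true :: s) - resample p i.+1 F' (true :: s))
      + (1 - p) * (F' (false :: s) - resample p i.+1 F' (false :: s)).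
    by rewrite /resample /av /=; ring.
  by rewrite (le_trans (ler_normD _ _))// !normrM (gtr0_norm p0) (gtr0_norm q0).
pose v F' := cubeE p n.+1 (fun s => `|de F' s| ^+ 2).
have v0 F' : 0 <= v F' by apply: cubeE_ge0 => s; exact: sqr_ge0.
have a0 F' := cube_inf_ge0 n.+1 0 F'.
(* The L^1 norm of [de F] is the influence of bit 0 by definition, so interpolating both L^q norms
   gives the contribution of this bit. *)
have Tde : cubeT p r n.+1 (de F) (de G) <=
    (cube_inf p n.+1 0 F * cube_inf p n.+1 0 G) `^ th * Num.sqrt (v F * v G) `^ (1 - th).
  apply: (le_trans (cubeT_le_norm _ _ _ hr)).
  apply: (le_trans (cubeT_hypercontractive _ _ _)) => //.
  have lyap F' : cubeE p n.+1 (fun s => `|de F' s| `^ q) `^ q^-1 <=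
      cube_inf p n.+1 0 F' `^ th * v F' `^ ((1 - th) / 2).
    exact: (@cubeE_lyapunov q n.+1 (fun s => `|de F' s|) hq).
  apply: (le_trans (ler_pM _ _ (lyap F) (lyap G))); rewrite ?powR_ge0//.
  by rewrite mulrACA -!powRM// [(1 - th) / 2]mulrC (powRrM _ 2^-1 (1 - th)) powR12_sqrt ?mulr_ge0.
pose S := \sum_(i < n) cube_inf p n i (av F) * cube_inf p n i (av G).
have S0 : 0 <= S by apply: sumr_ge0 => i _; rewrite mulr_ge0 ?cube_inf_ge0.
have th0 : 0 <= th by rewrite ltW// (andP hth).1.
have th1 : 0 <= 1 - th by rewrite subr_ge0 ltW// (andP hth).2.
rewrite Tsplit !Eav -addrA.
apply: (le_trans (lerD Tde (IHn (av F) (av G)))); rewrite -/S.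
rewrite [X in _ + X]mulrC.
apply: (le_trans (powR_hoelder2 hth _ _ _ _)); rewrite ?mulr_ge0 ?sqrtr_ge0//.
rewrite mulrC; apply: ler_pM; rewrite ?powR_ge0//.
  apply: (ge0_ler_powR th1); rewrite ?nnegrE ?addr_ge0 ?sqrtr_ge0//.
  by rewrite !Vsplit sqrt_add_le ?cube_var_ge0 ?v0.
apply: (ge0_ler_powR th0); rewrite ?nnegrE ?addr_ge0 ?mulr_ge0//.
  by apply: sumr_ge0 => i _; rewrite mulr_ge0 ?cube_inf_ge0.
rewrite big_ord_recl lerD2l; apply: ler_sum => i _.
by rewrite lift0 ler_pM ?cube_inf_ge0 ?inf_av.
Qed.

End noise.
End bounded.
End cube.

(** * Recursive expectations as sums over bit strings *)

Section allseq.
Context {T : eqType}.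
Implicit Types (b : seq T) (n : nat).

Fixpoint allseq b n : seq (seq T) :=
  if n is n'.+1 then [seq x :: s | x <- b, s <- allseq b n'] else [:: [::]].

Lemma sum_allseqS (V : nmodType) b n (F : seq T -> V) :
  \sum_(s <- allseq b n.+1) F s = \sum_(x <- b) \sum_(s <- allseq b n) F (x :: s).
Proof. by rewrite /= big_allpairs_dep. Qed.

Lemma mem_allseq b n s : size s = n -> {subset s <= b} -> s \in allseq b n.
Proof.
elim: n s => [|n IHn] [|x s] //= [sn] sb; apply: allpairs_f; first exact: sb (mem_head _ _).
by apply: IHn => // y ys; apply: sb; rewrite inE ys orbT.
Qed.

Lemma size_allseq b n s : s \in allseq b n -> size s = n.
Proof.
elim: n s => [|n IHn] s /=; first by rewrite inE => /eqP ->.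
by move=> /allpairsP[[x s'] /= [_ /IHn <- ->]].
Qed.

Lemma uniq_allseq b n : uniq b -> uniq (allseq b n).
Proof.
by move=> ub; elim: n => [//|n IHn] /=; apply: allpairs_uniq => // -[x s] [y s'] _ _ [-> ->].
Qed.

End allseq.

Section cube_sums.
Context {R : realType}.

Definition bern (p : R) (b : bool) : R := if b then p else 1 - p.

Definition cube_weight (p : R) (s : seq bool) : R := \prod_(b <- s) bern p b.

Definition joint_weight (p r : R) (z : bool * bool) : R :=
  r * (bern p z.1 * (z.1 == z.2)%:R) + (1 - r) * (bern p z.1 * bern p z.2).

Definition bools := [:: true; false].
Definition bool_pairs := [:: (true, true); (true, false); (false, true); (false, false)].

Lemma cubeE_sum p n F :
  cubeE p n F = \sum_(s <- allseq bools n) cube_weight p s * F s.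
Proof.
elim: n F => [|n IHn] F; first by rewrite /= big_seq1 /cube_weight big_nil mul1r.
rewrite sum_allseqS {1}/bools !big_cons big_nil addr0 /= !IHn !mulr_sumr.
by congr (_ + _); apply: eq_bigr => s _; rewrite /cube_weight big_cons /bern; ring.
Qed.

Lemma cubeT_sum p r n F G :
  cubeT p r n F G = \sum_(z <- allseq bool_pairs n)
     (\prod_(ab <- z) joint_weight p r ab) * (F (unzip1 z) * G (unzip2 z)).
Proof.
elim: n F G => [|n IHn] F G; first by rewrite /= big_seq1 big_nil mul1r.
rewrite sum_allseqS {1}/bool_pairs !big_cons big_nil addr0 [LHS]/= !IHn.
set S := fun a b => \sum_(z <- allseq bool_pairs n) (\prod_(ab <- z) joint_weight p r ab) *
   (F (a :: unzip1 z) * G (b :: unzip2 z)).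
rewrite -!/(S _ _).
have E a b : \sum_(z <- allseq bool_pairs n) (\prod_(ab <- (a, b) :: z) joint_weight p r ab) *
   (F (unzip1 ((a, b) :: z)) * G (unzip2 ((a, b) :: z))) = joint_weight p r (a, b) * S a b.
  by rewrite mulr_sumr; apply: eq_bigr => z _; rewrite big_cons -[LHS]mulrA.
by rewrite !E /joint_weight /bern /=; ring.
Qed.

Lemma cubeT_1l p r n G : cubeT p r n (fun=> 1) G = cubeE p n G :> R.
Proof. by elim: n G => [|n IHn] G /=; rewrite ?mul1r// !IHn; ring. Qed.

Lemma cubeT_1r p r n F : cubeT p r n F (fun=> 1) = cubeE p n F :> R.
Proof. by elim: n F => [|n IHn] F /=; rewrite ?mulr1// !IHn; ring. Qed.

(** Finite form of the independence of one bit from the others: as [F] ignores bit [i], both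
    branches of the recursion at that bit carry the same values. *)
Lemma cubeE_resample p n i (F : seq bool -> R) b : (i < n)%N ->
  (forall s c, F (set_nth false s i c) = F s) ->
  cubeE p n (fun s => F s * (nth false s i == b)%:R) = bern p b * cubeE p n F.
Proof.
elim: n i F => [//|n IHn] [|i] F /= ni hF.
  have E c s : F (c :: s) = F (true :: s) by rewrite -(hF (c :: s) true).
  have L c k : cubeE p n (fun s => F (c :: s) * k) = k * cubeE p n (fun s => F (true :: s)).
    rewrite -[RHS]addr0 -[X in _ = _ + X](mul0r (cubeE p n (fun s => F (true :: s)))) -cubeE_lin.
    by apply: cubeE_eq => s; rewrite E; ring.
  have L1 : cubeE p n (fun s => F (false :: s)) = cubeE p n (fun s => F (true :: s)).
    by apply: cubeE_eq => s; rewrite E.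
  by rewrite !L L1 /bern; case: (b); rewrite ?eqE /= ?mulr1n ?mulr0n; ring.
have h a s c : F (a :: set_nth false s i c) = F (a :: s) by exact: (hF (a :: s)).
rewrite (IHn i (fun s => F (true :: s)) ni (h true)).
by rewrite (IHn i (fun s => F (false :: s)) ni (h false)); ring.
Qed.

End cube_sums.

(** * Law of the bits and of their noisy version *)

Section finite_valued.
Context {R : realType} {d : measure_display} {Omega : measurableType d} (P : probability Omega R).

Lemma Rintegral_bigsum (I : Type) (s : seq I) (f : I -> Omega -> R) :
  (forall i, P.-integrable setT (EFin \o f i)) ->
  P.-integrable setT (EFin \o (fun w => \sum_(i <- s) f i w)) /\
  \int[P]_w (\sum_(i <- s) f i w) = \sum_(i <- s) \int[P]_w f i w.
Proof.
move=> hf; elim: s => [|i s [IH1 IH2]].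
  split; first by under eq_fun do rewrite /= big_nil; exact: integrable0.
  rewrite big_nil; under eq_Rintegral do rewrite big_nil.
  by rewrite Rintegral_cst// mul0r.
have E : (fun w => \sum_(j <- i :: s) f j w) = (fun w => f i w + \sum_(j <- s) f j w).
  by apply/funext => w; rewrite big_cons.
rewrite E; split; first by have := integrableD measurableT (hf i) IH1.
by rewrite RintegralD// big_cons IH2.
Qed.

(** Splits an integral over the atoms of [Z]. With [xi = 1] it yields the law of the prefixes, with
    a general [xi] the conditional means given a prefix. *)
Lemma integral_finite_valued (T : eqType) (Z : Omega -> T) (L : seq T) (xi : Omega -> R) (H : T -> R) :
  uniq L -> (forall w, Z w \in L) -> (forall z, measurable [set w | Z w = z]) ->
  P.-integrable setT (EFin \o xi) ->
  P.-integrable setT (EFin \o (fun w => xi w * H (Z w))) /\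
  \int[P]_w (xi w * H (Z w)) = \sum_(z <- L) H z * \int[P]_(w in [set w | Z w = z]) xi w.
Proof.
move=> uL ZL mZ ixi.
have E : (fun w => xi w * H (Z w)) =
    (fun w => \sum_(z <- L) H z * (xi \_ [set w | Z w = z]) w).
  apply/funext => w; rewrite (bigD1_seq (Z w))//= patchE mem_set//= big1 ?addr0 1?mulrC//.
  by move=> z zZ; rewrite patchE memNset ?mulr0//= => h; rewrite h eqxx in zZ.
have ir z : P.-integrable setT (EFin \o (xi \_ [set w | Z w = z])).
  rewrite -restrict_EFin; apply: (iffLR (integrable_mkcond _ (mZ z))).
  by apply: (integrableS measurableT _ (@subsetT _ _)) ixi => //; exact: mZ.
have iH z : P.-integrable setT (EFin \o (fun w => H z * (xi \_ [set w | Z w = z]) w)).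
  by have := integrableZl measurableT (H z) (ir z).
rewrite E; have [h1 h2] := Rintegral_bigsum L iH; split=> //.
by rewrite h2; apply: eq_bigr => z _; rewrite RintegralZl// -Rintegral_mkcond.
Qed.

Lemma measurable_mkseq (T : eqType) (Z : nat -> Omega -> T) n z :
  (forall i c, measurable [set w | Z i w = c]) ->
  measurable [set w | mkseq (fun i => Z i w) n = z].
Proof.
move=> mZ; elim: n z => [|n IHn] z; first by case: z => [|x z]; [rewrite (_ : mkset _ = setT)|rewrite (_ : mkset _ = set0)] => //; apply/seteqP; split.
case: (lastP z) => [|z' x].
  by rewrite (_ : mkset _ = set0)//; apply/seteqP; split => w //=.
rewrite (_ : mkset _ = [set w | mkseq (fun i => Z i w) n = z'] `&` [set w | Z n w = x]).
  exact: measurableI.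
apply/seteqP; split => w /=; first by rewrite mkseqS => /eqP; rewrite eqseq_rcons => /andP[/eqP -> /eqP ->].
by rewrite mkseqS => -[-> ->].
Qed.

End finite_valued.

Section noisy_pairs.
Context {R : realType} {d : measure_display} {Omega : measurableType d} (P : probability Omega R).
Variables (p r : R) (X Y : nat -> Omega -> bool).
Hypothesis mXY : forall k ab, measurable [set w | (X k w, Y k w) = ab].
Hypothesis lawXY : forall n z, size z = n ->
  P [set w | mkseq (fun i => (X i w, Y i w)) n = z] = (\prod_(ab <- z) joint_weight p r ab)%:E.

Lemma Rintegral_pair n (F G : seq bool -> R) :
  P.-integrable setT (EFin \o (fun w => F (mkseq (fun i => X i w) n) * G (mkseq (fun i => Y i w) n))) /\
  \int[P]_w (F (mkseq (fun i => X i w) n) * G (mkseq (fun i => Y i w) n)) = cubeT p r n F G.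
Proof.
have [||||h1 h2] := @integral_finite_valued R d Omega P _
  (fun w => mkseq (fun i => (X i w, Y i w)) n) (allseq bool_pairs n) (fun=> 1)
  (fun z => F (unzip1 z) * G (unzip2 z)).
- exact: uniq_allseq.
- by move=> w; apply: mem_allseq; [rewrite size_mkseq|move=> [[] []]].
- by move=> z; exact: measurable_mkseq.
- exact: finite_measure_integrable_cst.
have E : (fun w => 1 * (F (unzip1 (mkseq (fun i => (X i w, Y i w)) n)) *
    G (unzip2 (mkseq (fun i => (X i w, Y i w)) n)))) =
   (fun w => F (mkseq (fun i => X i w) n) * G (mkseq (fun i => Y i w) n)).
  by apply/funext => w; rewrite mul1r /unzip1 /unzip2 -!map_comp.
rewrite E in h1 h2; split=> //; rewrite h2 cubeT_sum.
rewrite big_seq_cond [RHS]big_seq_cond; apply: eq_bigr => z; rewrite andbT => zL.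
rewrite Rintegral_cst; last exact: measurable_mkseq.
have lz := congr1 fine (lawXY (size_allseq zL)).
by rewrite mul1r mulrC; congr (_ * _); exact: lz.
Qed.

Lemma Rintegral_fst n (F : seq bool -> R) :
  P.-integrable setT (EFin \o (fun w => F (mkseq (fun i => X i w) n))) /\
  \int[P]_w F (mkseq (fun i => X i w) n) = cubeE p n F.
Proof.
have := Rintegral_pair n F (fun=> 1).
rewrite (_ : (fun w => _) = (fun w => F (mkseq (fun i => X i w) n))) ?cubeT_1r//.
by apply/funext => w; rewrite mulr1.
Qed.

Lemma Rintegral_snd n (G : seq bool -> R) :
  P.-integrable setT (EFin \o (fun w => G (mkseq (fun i => Y i w) n))) /\
  \int[P]_w G (mkseq (fun i => Y i w) n) = cubeE p n G.
Proof.
have := Rintegral_pair n (fun=> 1) G.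
rewrite (_ : (fun w => _) = (fun w => G (mkseq (fun i => Y i w) n))) ?cubeT_1l//.
by apply/funext => w; rewrite mul1r.
Qed.

End noisy_pairs.

Section joint_law.
Context {R : realType} (p t : R) (hp : 0 < p < 1) (ht : 0 < t)
  (d : measure_display) (Omega : measurableType d) (P : probability Omega R)
  (X X' : nat -> {RV P >-> bool}) (U : nat -> {RV P >-> R})
  (hX : forall i, distribution P (X i) = bernoulli_prob p)
  (hX' : forall i, distribution P (X' i) = bernoulli_prob p)
  (hU : forall i, distribution P (U i) = exponential_prob 1)
  (hind : mutually_independent P (fun k : nat * src =>
     match k.2 with
     | srcX => sigma_of (X k.1)
     | srcX' => sigma_of (X' k.1)
     | srcU => sigma_of (U k.1)
     end)).

Let r := expR (- t).
Let bernE (Y : {RV P >-> bool}) b : distribution P Y = bernoulli_prob p ->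
  P (Y @^-1` [set b]) = (bern p b)%:E.
Proof.
move=> hY; transitivity (distribution P Y [set b]) => //; rewrite hY bernoulli_probE; last first.
  by case/andP: hp => ? ?; rewrite !ltW.
have E c : (c \in [set b]) = (c == b) by apply/idP/eqP; rewrite inE.
by rewrite !diracE /bern !E; case: (b); rewrite /= ?mule1 ?mule0 ?adde0 ?add0e.
Qed.

Let U_le i : P (U i @^-1` `]-oo, t]) = (1 - r)%:E.
Proof.
transitivity (distribution P (U i) `]-oo, t]) => //; rewrite hU.
(* The exponential density vanishes on the negative half-line, so only [[0, t]] has mass. *)
rewrite (_ : `]-oo, t]%classic = `]-oo, 0[%classic `|` `[0, t]%classic); last first.
  apply/seteqP; split => x /=; rewrite !in_itv/=.
    by move=> xt; case: (ltP x 0); [left|right].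
  by case=> [x0|/andP[]//]; rewrite ltW// (lt_trans x0).
rewrite measureU//=; last first.
  apply/seteqP; split => x //=; rewrite !in_itv/= => -[x0 /andP[]].
  by rewrite leNgt x0.
rewrite exponential_prob_itv0c// mulN1r -/r.
rewrite [exponential_prob _ _](_ : _ = 0%E) ?add0r//.
rewrite /exponential_prob integral0_eq// => x /=; rewrite in_itv/= => x0.
by rewrite lt0_exponential_pdf.
Qed.

Let U_gt i : P (U i @^-1` `]t, +oo[) = r%:E.
Proof.
have -> : U i @^-1` `]t, +oo[ = ~` (U i @^-1` `]-oo, t]).
  by apply/seteqP; split => x /=; rewrite !in_itv/= andbT ltNge => /negP.
rewrite probability_setC//; last exact: measurable_funPTI.
by rewrite U_le -EFinB; congr EFin; ring.
Qed.

(** Events of product form, to which the mutual independence of the three families applies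
    directly. *)
Let box i (B1 B2 : set bool) (B3 : set R) : set Omega :=
  X i @^-1` B1 `&` (X' i @^-1` B2 `&` U i @^-1` B3).

Let measurable_box i B1 B2 B3 : measurable B3 -> measurable (box i B1 B2 B3).
Proof.
by move=> mB3; apply: measurableI; [|apply: measurableI]; exact: measurable_funPTI.
Qed.

Let wt i (B1 B2 : set bool) (B3 : set R) : R :=
  fine (P (X i @^-1` B1)) * (fine (P (X' i @^-1` B2)) * fine (P (U i @^-1` B3))).

Let box_indep n (B1 B2 : nat -> set bool) (B3 : nat -> set R) :
  (forall i, measurable (B3 i)) ->
  P (\big[setI/setT]_(0 <= i < n) box i (B1 i) (B2 i) (B3 i)) =
  (\prod_(0 <= i < n) wt i (B1 i) (B2 i) (B3 i))%:E.
Proof.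
move=> mB3.
pose A (k : nat * src) : set Omega := match k.2 with
  | srcX => X k.1 @^-1` B1 k.1
  | srcX' => X' k.1 @^-1` B2 k.1
  | srcU => U k.1 @^-1` B3 k.1 end.
have := @hind [seq (i, c) | i <- index_iota 0 n, c <- [:: srcX; srcX'; srcU]] A.
rewrite !big_allpairs => h.
transitivity (P (\big[setI/setT]_(i1 <- index_iota 0 n)
      \big[setI/setT]_(i2 <- [:: srcX; srcX'; srcU]) A (i1, i2))).
  by congr (P _); apply: eq_bigr => i _; rewrite !big_cons big_nil setIT.
rewrite h.
- rewrite -prodEFin; apply: eq_bigr => i _.
  rewrite !big_cons big_nil /wt !EFinM /A /= mule1 !fineK//; apply: fin_num_measure;
  exact: measurable_funPTI.
- by apply: allpairs_uniq => //; [exact: iota_uniq|move=> [? ?] [? ?]].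
- by move=> [i []] _ /=; rewrite /A/=; [exists (B1 i)|exists (B2 i)|exists (B3 i)].
Qed.

Let Y i (w : Omega) : bool := if t < U i w then X i w else X' i w.

Fixpoint law_tail k (z : seq (bool * bool)) : set Omega :=
  if z is ab :: z' then [set w | (X k w, Y k w) = ab] `&` law_tail k.+1 z' else setT.

Let pairE k a b : [set w | (X k w, Y k w) = (a, b)] =
  box k (if a == b then [set a] else set0) setT `]t, +oo[ `|` box k [set a] [set b] `]-oo, t].
Proof.
apply/seteqP; split => w /=; rewrite /Y /box/= !in_itv/= andbT.
  case=> <-; case: ltP => tU; last by right.
  by move=> <-; rewrite eqxx; left.
case=> [[+ [_ tU]]|[-> [-> tU]]]; last by rewrite ltNge tU.
by rewrite tU; case: eqP => [->|_] //= ->.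
Qed.

Lemma measurable_XY k ab : measurable [set w | (X k w, Y k w) = ab].
Proof.
by case: ab => a b; rewrite pairE; apply: measurableU; exact: measurable_box.
Qed.

Lemma measurable_law_tail k z : measurable (law_tail k z).
Proof.
by elim: z k => [|ab z IHz] k //=; apply: measurableI => //; exact: measurable_XY.
Qed.

(** A prescribed value of the pair [(X k, Y k)] is a disjoint union of two boxes, not a box.
    Carrying [k] arbitrary boxes in front lets the induction on [z] split one pair at a time and
    move either box to the front, until only boxes remain. *)
Let law_tailE z k (B1 B2 : nat -> set bool) (B3 : nat -> set R) :
  (forall i, measurable (B3 i)) ->
  P (\big[setI/setT]_(0 <= i < k) box i (B1 i) (B2 i) (B3 i) `&` law_tail k z) =
  ((\prod_(0 <= i < k) wt i (B1 i) (B2 i) (B3 i)) * \prod_(ab <- z) joint_weight p r ab)%:E.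
Proof.
elim: z k B1 B2 B3 => [|[a b] z IHz] k B1 B2 B3 mB3.
  by rewrite /= setIT box_indep// big_nil mulr1.
have step C1 C2 C3 : measurable C3 ->
   P (\big[setI/setT]_(0 <= i < k) box i (B1 i) (B2 i) (B3 i) `&` (box k C1 C2 C3 `&` law_tail k.+1 z)) =
  ((\prod_(0 <= i < k) wt i (B1 i) (B2 i) (B3 i)) * wt k C1 C2 C3 * \prod_(ab <- z) joint_weight p r ab)%:E.
  move=> mC3.
  (* Extends each family of sides by the new box at index [k]. *)
  pose u T (B : nat -> T) C i := if i == k then C else B i.
  have := @IHz k.+1 (u _ B1 C1) (u _ B2 C2) (u _ B3 C3).
  rewrite !big_nat_recr//= /u !eqxx -setIA.
  have E T (B : nat -> T) C i : (0 <= i < k)%N -> (if i == k then C else B i) = B i.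
    by move=> /andP[_ ik]; rewrite ltn_eqF.
  under eq_big_nat => i ik do rewrite !E//.
  under [X in (X * _ * _)%:E]eq_big_nat => i ik do rewrite !E//.
  by apply => i; case: eqP.
rewrite /= pairE setIUl setIUr measureU.
- have e1 := step (if a == b then [set a] else set0) setT `]t, +oo[%classic (measurable_itv _).
  have e2 := step [set a] [set b] `]-oo, t]%classic (measurable_itv _).
  etransitivity; first exact: (congr2 (fun x y : \bar R => (x + y)%E) e1 e2).
  rewrite /= -EFinD; congr EFin.
  rewrite big_cons /wt U_gt U_le !bernE// preimage_setT probability_setT/=.
  rewrite /joint_weight /=; case: (a =P b) => [<-|ab].
    by rewrite bernE//=; ring.
  by rewrite preimage_set0 measure0/=; ring.
- by apply: measurableI; [apply: bigsetI_measurable => i _; exact: measurable_box|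
    apply: measurableI; [exact: measurable_box|exact: measurable_law_tail]].
- by apply: measurableI; [apply: bigsetI_measurable => i _; exact: measurable_box|
    apply: measurableI; [exact: measurable_box|exact: measurable_law_tail]].
- apply/seteqP; split => w //= [[_ [[_ [_ +]] _]] [_ [[_ [_ +]] _]]].
  by rewrite /= !in_itv/= andbT => h1; rewrite leNgt h1.
Qed.

Let tail_mkseq k z : law_tail k z = [set w | [seq (X i w, Y i w) | i <- iota k (size z)] = z].
Proof.
elim: z k => [|ab z IHz] k /=; first by apply/seteqP; split.
rewrite IHz; apply/seteqP; split => w /=; first by move=> [-> ->].
by move=> [-> ->].
Qed.

Lemma joint_law n z : size z = n ->
  P [set w | mkseq (fun i => (X i w, Y i w)) n = z] = (\prod_(ab <- z) joint_weight p r ab)%:E.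
Proof.
move=> <-; rewrite -tail_mkseq.
have := @law_tailE z 0%N (fun=> setT) (fun=> setT) (fun=> setT).
by rewrite !big_nil setTI mul1r => ->.
Qed.

End joint_law.

(** * Sequences of independent bits *)

Section cantor.

(** A generating class that, unlike [cylinders], is closed under intersection, as uniqueness of
    measures and Dynkin induction require. *)
Definition prefix_sets : set (set Cantor) :=
  [set A | exists n (S : seq bool -> bool), A = [set x | S (mkseq x n)]].

Lemma take_mkseq_add T (x : nat -> T) n m : take n (mkseq x (n + m)) = mkseq x n.
Proof. by rewrite /mkseq -map_take take_iota minnE; congr map; congr iota; lia. Qed.

Lemma prefix_sets_setI : setI_closed prefix_sets.
Proof.
move=> A B [n [S ->]] [m [S' ->]].
exists (n + m)%N, (fun s => S (take n s) && S' (take m s)).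
apply/seteqP; split => x /=; rewrite take_mkseq_add addnC take_mkseq_add.
  by move=> [-> ->].
by move=> /andP[].
Qed.

Lemma measurable_coord i (c : bool) : measurable ([set x | x i = c] : set Cantor).
Proof. by apply: sub_sigma_algebra; exists i, c. Qed.

Lemma measurable_prefix d (Omega : measurableType d) (X : nat -> Omega -> bool) n (S : seq bool -> bool) :
  (forall i c, measurable [set w | X i w = c]) ->
  measurable [set w | S (mkseq (fun i => X i w) n)].
Proof.
move=> mX.
have -> : [set w | S (mkseq (fun i => X i w) n)] =
    \big[setU/set0]_(z <- allseq bools n | S z) [set w | mkseq (fun i => X i w) n = z].
  apply/seteqP; split => w /=.
    move=> Sw; rewrite -bigcup_seq_cond; exists (mkseq (fun i => X i w) n) => //=.
    by rewrite Sw andbT; apply: mem_allseq; [rewrite size_mkseq|case].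
  by rewrite -bigcup_seq_cond => -[z /= /andP[_ Sz] ->].
by apply: bigsetU_measurable => z _; exact: measurable_mkseq.
Qed.

Lemma measurable_prefix_sets : @measurable _ Cantor = <<s prefix_sets >>.
Proof.
apply/seteqP; split.
  apply: smallest_sub; first exact: smallest_sigma_algebra.
  move=> _ [i [b ->]]; apply: sub_sigma_algebra.
  exists i.+1, (fun s => nth false s i == b).
  by apply/seteqP; split => x /=; rewrite nth_mkseq// => /eqP.
apply: smallest_sub; first exact: sigma_algebra_measurable.
move=> _ [n [S ->]]; apply: (@measurable_prefix _ Cantor (fun i x => x i)).
exact: measurable_coord.
Qed.

Lemma measurable_vec d (Omega : measurableType d) (X : nat -> Omega -> bool) :
  (forall i c, measurable [set w | X i w = c]) -> measurable_fun setT (vec X).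
Proof.
move=> mX; apply: (@measurability _ _ Omega Cantor setT (vec X) cylinders erefl).
by move=> _ [_ [i [b ->]] <-]; rewrite setTI; exact: mX.
Qed.

End cantor.

(** * What the law of the prefixes determines *)

Section bernoulli_sequence.
Context {R : realType} {d : measure_display} {Omega : measurableType d} (P : probability Omega R).
Implicit Types (X Y : nat -> Omega -> bool).

Lemma probability_Rintegral (A : set Omega) : measurable A -> P A = (\int[P]_w \1_A w)%:E.
Proof.
by move=> mA; rewrite /Rintegral integral_indic// setIT fineK// fin_num_measure.
Qed.

(** What the bits and their noisy version have in common; it allows integrals to be carried from one
    to the other. *)
Definition bernoulli_seq (p : R) X := (forall i c, measurable [set w | X i w = c]) /\
  forall n (F : seq bool -> R),
  P.-integrable setT (EFin \o (fun w => F (mkseq (fun i => X i w) n))) /\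
  \int[P]_w F (mkseq (fun i => X i w) n) = cubeE p n F.

Lemma bernoulli_seq_prefix p X n (S : seq bool -> bool) : bernoulli_seq p X ->
  P [set w | S (mkseq (fun i => X i w) n)] = (cubeE p n (fun s => (S s)%:R))%:E.
Proof.
move=> [mX lX]; rewrite probability_Rintegral; last exact: measurable_prefix.
rewrite -(lX n (fun s => (S s)%:R)).2; congr EFin.
apply: eq_Rintegral => w _; rewrite indicE; congr (_%:R); congr nat_of_bool.
by apply/idP/idP; rewrite inE.
Qed.

Lemma bernoulli_seq_law p X Y : bernoulli_seq p X -> bernoulli_seq p Y ->
  forall B : set Cantor, measurable B -> P (vec X @^-1` B) = P (vec Y @^-1` B).
Proof.
move=> hX hY B mB.
have mX := measurable_vec hX.1; have mY := measurable_vec hY.1.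
apply: (@measure_unique _ R Cantor prefix_sets (fun=> setT) measurable_prefix_sets
  prefix_sets_setI _ _ (pushforward P (vec X)) (pushforward P (vec Y))) => //.
- by move=> _; exists 0%N, (fun=> true); apply/seteqP.
- by rewrite bigcup_const.
- move=> _ [n [S ->]]; apply: (etrans (bernoulli_seq_prefix n S hX)).
  exact: (esym (bernoulli_seq_prefix n S hY)).
- move=> _; apply: (@le_lt_trans _ _ 1%E); last exact: ltry.
  by apply: probability_le1; rewrite -[_ @^-1` _]setTI; exact: mX.
Qed.

Lemma bernoulli_seq_ge0_integral p X Y (phi : Cantor -> R) :
  bernoulli_seq p X -> bernoulli_seq p Y ->
  measurable_fun setT phi -> (forall x, 0 <= phi x) ->
  (\int[P]_w (phi (vec X w))%:E = \int[P]_w (phi (vec Y w))%:E)%E.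
Proof.
move=> hX hY mphi phi0.
have mX := measurable_vec hX.1; have mY := measurable_vec hY.1.
have mphiE : measurable_fun setT (EFin \o phi) by exact/measurable_EFinP.
have phi0E x : x \in (setT : set Cantor) -> (0 <= (EFin \o phi) x)%E by rewrite lee_fin.
have := @ge0_integral_pushforward _ _ _ _ R (vec X) mX P setT _ measurableT mphiE phi0E.
rewrite preimage_setT => <-.
have := @ge0_integral_pushforward _ _ _ _ R (vec Y) mY P setT _ measurableT mphiE phi0E.
rewrite preimage_setT => <-.
by apply: eq_measure_integral => A mA _; exact: (bernoulli_seq_law hX hY).
Qed.

Lemma bernoulli_seq_integral p X Y (phi : Cantor -> R) :
  bernoulli_seq p X -> bernoulli_seq p Y -> measurable_fun setT phi ->
  P.-integrable setT (EFin \o (phi \o vec X)) ->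
  P.-integrable setT (EFin \o (phi \o vec Y)) /\
  \int[P]_w phi (vec X w) = \int[P]_w phi (vec Y w).
Proof.
move=> hX hY mphi iX.
have mX := measurable_vec hX.1; have mY := measurable_vec hY.1.
have mphiE : measurable_fun setT (EFin \o phi) by exact/measurable_EFinP.
have iY : P.-integrable setT (EFin \o (phi \o vec Y)).
  case/integrableP: iX => _ fin; apply/integrableP; split.
    by apply: measurableT_comp => //; exact: measurableT_comp.
  rewrite (le_lt_trans _ fin)//= -(@bernoulli_seq_ge0_integral p X Y (fun x => `|phi x|))//.
  exact: measurableT_comp.
split=> //; rewrite /Rintegral; congr fine.
have := @integral_pushforward _ _ _ _ R (vec X) mX P setT _ mphiE iX measurableT.
rewrite preimage_setT => <-.
have := @integral_pushforward _ _ _ _ R (vec Y) mY P setT _ mphiE iY measurableT.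
rewrite preimage_setT => <-.
by apply: eq_measure_integral => A mA _; exact: (bernoulli_seq_law hX hY).
Qed.

(** With bit [i] frozen, [vec (reset i X)] depends on the other bits only, and every event of
    [sigma_but X i] is a preimage under it. *)
Let reset (i : nat) X (j : nat) (w : Omega) : bool := if j == i then false else X j w.

Lemma mkseq_reset i X n w : (i < n)%N ->
  mkseq (fun j => reset i X j w) n = set_nth false (mkseq (fun j => X j w) n) i false.
Proof.
move=> ni; apply: (@eq_from_nth _ false).
  by rewrite size_set_nth !size_mkseq; apply/esym/maxn_idPr.
move=> j; rewrite size_mkseq => jn; rewrite nth_set_nth /= !nth_mkseq// /reset.
Qed.

(** Writing [A] as a preimage of [B] under [vec W], both sides are finite measures of [B]; they
    agree on prefix sets by [cubeE_resample], hence everywhere. *)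
Lemma bernoulli_seq_indep p X i b (A : set Omega) : 0 < p < 1 -> bernoulli_seq p X ->
  sigma_but X i A ->
  measurable A /\ P (A `&` [set w | X i w = b]) = ((bern p b)%:E * P A)%E.
Proof.
move=> hp hX hA.
have bern0 : 0 <= bern p b by rewrite /bern; case: b; lra.
pose W := reset i X.
have mW : forall j c, measurable [set w | W j w = c].
  move=> j c; rewrite /W /reset; case: eqP => _; last exact: hX.1.
  by case: c; [rewrite (_ : mkset _ = set0)|rewrite (_ : mkset _ = setT)] => //; apply/seteqP; split.
have mvW := measurable_vec mW.
have [B mB AE] : exists2 B : set Cantor, measurable B & A = vec W @^-1` B.
  have : preimage_set_system setT (vec W) (@measurable _ Cantor) A.
    apply: (smallest_sub _ _ hA).
      by apply: sigma_algebra_preimage; exact: sigma_algebra_measurable.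
    move=> _ [j /= ji [C _ ->]].
    exists [set x | C (x j)].
      have -> : [set x : Cantor | C (x j)] =
          (if `[< C true >] then [set x : Cantor | x j = true] else set0) `|`
          (if `[< C false >] then [set x : Cantor | x j = false] else set0).
        apply/seteqP; split => x /=.
          by case E : (x j) => h; [left|right]; rewrite asboolT.
        by case; case: asboolP => //= h ->.
      by apply: measurableU; case: ifP => _ //; exact: measurable_coord.
    rewrite setTI; apply/seteqP; split => w; rewrite /W /= /vec /reset /=.
      by case: eqP.
    by case: eqP.
  by move=> [B mB <-]; exists B => //; rewrite setTI.
have mA : measurable A by rewrite AE -[X in measurable X]setTI; exact: mvW.
split=> //; rewrite {mA} AE.
have mE : measurable [set w | X i w = b] by exact: hX.1.
apply: (@measure_unique _ R Cantor prefix_sets (fun=> setT) measurable_prefix_sets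
  prefix_sets_setI _ _ (pushforward (mrestr P mE) (vec W))
   (mscale (NngNum bern0) (pushforward P (vec W)))) => //.
- by move=> _; exists 0%N, (fun=> true); apply/seteqP.
- by rewrite bigcup_const.
- move=> _ [n [S ->]]; rewrite /pushforward /mscale /mrestr /=.
  (* A prefix long enough to contain bit [i] as well. *)
  pose N := (n + i.+1)%N.
  have iN : (i < N)%N by rewrite /N; lia.
  pose S' s := S (take n (set_nth false s i false)).
  have E1 : vec W @^-1` [set x | S (mkseq x n)] = [set w | S' (mkseq (fun j => X j w) N)].
    by apply/seteqP; split => w /=; rewrite /S' -mkseq_reset// take_mkseq_add.
  suff : P (vec W @^-1` [set x | S (mkseq x n)] `&` [set w | X i w = b]) =
      ((bern p b)%:E * P (vec W @^-1` [set x | S (mkseq x n)]))%E by [].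
  rewrite E1 (_ : _ `&` _ = [set w | (fun s => S' s && (nth false s i == b)) (mkseq (fun j => X j w) N)]); last first.
    apply/seteqP; split => w /=; rewrite nth_mkseq//; first by move=> [-> ->]; rewrite eqxx.
    by move=> /andP[-> /eqP].
  rewrite (bernoulli_seq_prefix N (fun s => S' s && (nth false s i == b)) hX).
  rewrite (bernoulli_seq_prefix N S' hX) -EFinM; congr EFin.
  rewrite -(@cubeE_resample _ _ _ i)//; last by move=> s c; rewrite /S' set_set_nth eqxx.
  by apply: cubeE_eq => s; rewrite -natrM mulnb.
- move=> _; apply: (@le_lt_trans _ _ 1%E); last exact: ltry.
  by apply: probability_le1; apply: measurableI => //; rewrite -[_ @^-1` _]setTI; exact: mvW.
Qed.

End bernoulli_sequence.

(** * Integration over an independent event *)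

Section independent_integral.
Context {R : realType} {d : measure_display} {Omega : measurableType d} (P : probability Omega R).

Let ge0_integral_indep (h : Omega -> R) (B E : set Omega) (c : R) :
  0 <= c -> measurable_fun setT h -> (forall w, 0 <= h w) -> measurable B -> measurable E ->
  (forall A : set R, measurable A -> P (h @^-1` A `&` B `&` E) = (c%:E * P (h @^-1` A `&` B))%E) ->
  (\int[P]_(w in B `&` E) (h w)%:E = c%:E * \int[P]_(w in B) (h w)%:E)%E.
Proof.
move=> c0 mh h0 mB mE hind.
(* The half-line excludes 0, the value of the cut-off function outside [C]: on positive sets the
   pushforward sees only [h] on [C], where the independence hypothesis applies. *)
have pushE C : measurable C -> (\int[P]_(w in C) (h w)%:E =
    \int[pushforward P (h \_ C)]_(y in `]0%R, +oo[) y%:E)%E.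
  move=> mC.
  have mk : measurable_fun setT (h \_ C).
    by apply/(measurable_restrictT _ _).1 => //; exact: measurable_funS mh.
  rewrite ge0_integral_pushforward//; last first.
    by move=> y; rewrite inE/= in_itv/= andbT lee_fin => /ltW.
  transitivity (\int[P]_w ((h \_ C) w)%:E)%E.
    by rewrite integral_mkcond; under eq_integral do rewrite restrict_EFin.
  apply/esym; rewrite integral_mkcond; apply: eq_integral => w _.
  rewrite patchE; case: ifPn => //= nw.
  congr EFin; move: nw; rewrite notin_setE/= in_itv/= andbT => /negP; rewrite -leNgt => k0.
  apply/le_anti/andP; split => //; rewrite patchE; case: ifP => // _; exact: h0.
rewrite (pushE _ mB) (pushE _ (measurableI _ _ mB mE)).
have mk : measurable_fun setT (h \_ B).
  by apply/(measurable_restrictT _ _).1 => //; exact: measurable_funS mh.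
have mkE : measurable_fun setT (h \_ (B `&` E)).
  by apply/(measurable_restrictT _ _).1; [exact: measurableI|exact: measurable_funS mh].
have := @ge0_integral_mscale _ _ R (pushforward P (h \_ B)) `]0%R, +oo[%classic (measurable_itv _)
  (NngNum c0) EFin.
move=> <- //; last first.
  by move=> y /=; rewrite in_itv/= andbT lee_fin => /ltW.
apply: eq_measure_integral => A mA Apos.
have preE C : (h \_ C) @^-1` A = h @^-1` A `&` C.
  apply/seteqP; split => w /=; rewrite patchE.
    case: ifPn => [|_ /Apos]; first by rewrite inE.
    by rewrite /= in_itv/= ltxx.
  by move=> [hA Cw]; rewrite mem_set.
suff : P ((h \_ (B `&` E)) @^-1` A) = (c%:E * P ((h \_ B) @^-1` A))%E by [].
by rewrite !preE setIA hind.
Qed.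

Lemma Rintegral_indep (h : Omega -> R) (B E : set Omega) (c : R) :
  0 <= c -> P.-integrable setT (EFin \o h) -> measurable B -> measurable E ->
  (forall A : set R, measurable A -> P (h @^-1` A `&` B `&` E) = (c%:E * P (h @^-1` A `&` B))%E) ->
  \int[P]_(w in B `&` E) h w = c * \int[P]_(w in B) h w.
Proof.
move=> c0 ih mB mE hind.
have mh : measurable_fun setT h by apply/measurable_EFinP; exact: measurable_int ih.
pose pp (x : R) := Num.max x 0; pose nn (x : R) := Num.max (- x) 0.
have mpp : measurable_fun setT pp by apply: measurable_maxr => //; exact: measurable_cst.
have mnn : measurable_fun setT nn.
  by apply: measurable_maxr; [exact: measurable_funN|exact: measurable_cst].
have int (k : R -> R) : measurable_fun setT k -> (forall x, 0 <= k x) -> (forall x, k x <= `|x|) ->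
    P.-integrable setT (EFin \o (k \o h)) /\
    \int[P]_(w in B `&` E) (k \o h) w = c * \int[P]_(w in B) (k \o h) w.
  move=> mk k0 kn.
  have ik : P.-integrable setT (EFin \o (k \o h)).
    apply: (le_integrable measurableT _ _ ih).
      by apply/measurable_EFinP; exact: measurableT_comp.
    by move=> w _ /=; rewrite lee_fin ger0_norm// kn.
  split=> //; rewrite /Rintegral (@ge0_integral_indep (k \o h) B E c)//.
  - rewrite fineM//; apply: integrable_fin_num => //.
    exact: integrableS ik.
  - exact: measurableT_comp.
  - by move=> w; exact: k0.
  - move=> A mA; rewrite comp_preimage; apply: hind.
    by rewrite -[_ @^-1` _]setTI; exact: mk.
have [||i1 e1] := int pp mpp; first by move=> x; rewrite /pp le_max lexx orbT.
  by move=> x; rewrite /pp ge_max ler_norm normr_ge0.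
have [||i2 e2] := int nn mnn; first by move=> x; rewrite /nn le_max lexx orbT.
  by move=> x; rewrite /nn ge_max -normrN ler_norm normr_ge0.
have hE C : measurable C -> \int[P]_(w in C) h w =
    \int[P]_(w in C) (pp \o h) w - \int[P]_(w in C) (nn \o h) w.
  move=> mC; rewrite -RintegralB//; try exact: integrableS i1; try exact: integrableS i2.
  apply: eq_Rintegral => w _; rewrite /pp /nn /=.
  by case: (leP (h w) 0) => h0; case: (leP (- h w) 0) => h1; lra.
by rewrite (hE _ mB) (hE _ (measurableI _ _ mB mE)) e1 e2 mulrBr.
Qed.

End independent_integral.

(** * Density of cylinder functions in L^2 *)

Section density.
Context {R : realType} {d : measure_display} {Omega : measurableType d} (P : probability Omega R).
Variables (p : R) (X : nat -> Omega -> bool).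
Hypothesis hX : bernoulli_seq P p X.

Let pre n w := mkseq (fun i => X i w) n.
Let sqd (u v : Omega -> R) : \bar R := (\int[P]_w ((u w - v w) ^+ 2)%:E)%E.

Definition l2approx (u : Cantor -> R) := measurable_fun setT u /\
  forall e, 0 < e -> exists n (H : seq bool -> R), (sqd (u \o vec X) (H \o pre n) <= e%:E)%E.

Let mvX : measurable_fun setT (vec X). Proof. exact: measurable_vec hX.1. Qed.

Let measurable_pre n (H : seq bool -> R) : measurable_fun setT (H \o pre n).
Proof. by apply/measurable_EFinP; exact: measurable_int (hX.2 n H).1. Qed.

Let msq (u v : Omega -> R) : measurable_fun setT u -> measurable_fun setT v ->
  measurable_fun setT (EFin \o (fun w => (u w - v w) ^+ 2)).
Proof.
by move=> mu mv; apply/measurable_EFinP; apply: measurable_funX; exact: measurable_funB.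
Qed.

(** From [(x + y) ^ 2 <= 2 x ^ 2 + 2 y ^ 2]; this is why errors of [e / 4] are requested below. *)
Let sqd_le (a b c d0 u v : Omega -> R) (e1 e2 : R) :
  measurable_fun setT a -> measurable_fun setT b -> measurable_fun setT c ->
  measurable_fun setT d0 -> measurable_fun setT u -> measurable_fun setT v ->
  (forall w, u w - v w = (a w - b w) + (c w - d0 w)) ->
  (sqd a b <= e1%:E)%E -> (sqd c d0 <= e2%:E)%E ->
  (sqd u v <= (2 * e1 + 2 * e2)%:E)%E.
Proof.
move=> ma mb mc md mu mv E h1 h2.
apply: (@le_trans _ _ (\int[P]_w ((2 * (a w - b w) ^+ 2)%:E + (2 * (c w - d0 w) ^+ 2)%:E))%E).
  apply: ge0_le_integral => //.
  - by move=> w _; rewrite lee_fin sqr_ge0.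
  - exact: msq.
  - apply: emeasurable_funD; apply/measurable_EFinP; apply: measurable_funM => //;
      by apply/measurable_EFinP; exact: msq.
  - move=> w _; rewrite -EFinD lee_fin E -subr_ge0.
    set x := a w - b w; set y := c w - d0 w.
    have -> : 2 * x ^+ 2 + 2 * y ^+ 2 - (x + y) ^+ 2 = (x - y) ^+ 2 by ring.
    exact: sqr_ge0.
rewrite ge0_integralD//; last 4 first.
- by move=> w _; rewrite lee_fin mulr_ge0// sqr_ge0.
- by apply/measurable_EFinP; apply: measurable_funM => //; apply/measurable_EFinP; exact: msq.
- by move=> w _; rewrite lee_fin mulr_ge0// sqr_ge0.
- by apply/measurable_EFinP; apply: measurable_funM => //; apply/measurable_EFinP; exact: msq.
have Z (f g : Omega -> R) (e : R) : measurable_fun setT f -> measurable_fun setT g ->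
    (sqd f g <= e%:E)%E -> (\int[P]_w (2 * (f w - g w) ^+ 2)%:E <= (2 * e)%:E)%E.
  move=> mf mg fg; under eq_integral do rewrite EFinM.
  rewrite ge0_integralZl_EFin//; last 2 first.
  - by move=> w _; rewrite lee_fin sqr_ge0.
  - exact: msq.
  by rewrite EFinM lee_pmul2l.
by rewrite EFinD; apply: leeD; apply: Z.
Qed.

Lemma l2approx_close (u : Cantor -> R) : measurable_fun setT u ->
  (forall e, 0 < e -> exists2 v, l2approx v & (sqd (u \o vec X) (v \o vec X) <= e%:E)%E) ->
  l2approx u.
Proof.
move=> mu h; split=> // e e0.
have e40 : 0 < e / 4 by rewrite divr_gt0.
have [v [mv hv] uv] := h _ e40; have [n [H hH]] := hv _ e40.
exists n, H.
have -> : e = 2 * (e / 4) + 2 * (e / 4) by lra.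
apply: (@sqd_le (u \o vec X) (v \o vec X) (v \o vec X) (H \o pre n)) => //; try exact: measurableT_comp.
by move=> w; rewrite addrA subrK.
Qed.

Lemma l2approxD (u v : Cantor -> R) : l2approx u -> l2approx v -> l2approx (fun x => u x + v x).
Proof.
move=> [mu hu] [mv hv]; split; first exact: measurable_funD.
move=> e e0; have e40 : 0 < e / 4 by rewrite divr_gt0.
have [n [H hH]] := hu _ e40; have [m [G hG]] := hv _ e40.
exists (n + m)%N, (fun s => H (take n s) + G (take m s)).
have -> : e = 2 * (e / 4) + 2 * (e / 4) by lra.
apply: (@sqd_le (u \o vec X) (H \o pre n) (v \o vec X) (G \o pre m)) => //; try exact: measurableT_comp.
  by apply: measurableT_comp => //; exact: measurable_funD.
by move=> w; rewrite /pre /= take_mkseq_add addnC take_mkseq_add; ring.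
Qed.

Lemma l2approx_cst c : l2approx (fun=> c).
Proof.
split=> // e e0; exists 0%N, (fun=> c); rewrite /sqd.
by under eq_integral do rewrite subrr expr0n/=; rewrite integral0 lee_fin ltW.
Qed.

Lemma l2approxZ (c : R) (u : Cantor -> R) : l2approx u -> l2approx (fun x => c * u x).
Proof.
move=> [mu hu]; split; first exact: measurable_funM.
(* Adding 1 keeps the divisor positive when [c = 0]. *)
move=> e e0; have c20 : 0 < c ^+ 2 + 1 by rewrite ltr_pwDr// sqr_ge0.
have e'0 : 0 < e / (c ^+ 2 + 1) by rewrite divr_gt0.
have [n [H hH]] := hu _ e'0; exists n, (fun s => c * H s).
rewrite /sqd; under eq_integral do rewrite /= -mulrBr exprMn EFinM.
rewrite ge0_integralZl_EFin//; last 3 first.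
- by move=> w _; rewrite lee_fin sqr_ge0.
- by apply: (@msq (u \o vec X) (H \o pre n)) => //; exact: measurableT_comp.
- exact: sqr_ge0.
apply: (@le_trans _ _ ((c ^+ 2)%:E * (e / (c ^+ 2 + 1))%:E)%E).
  by apply: lee_wpmul2l => //; rewrite lee_fin sqr_ge0.
rewrite -EFinM lee_fin mulrA ler_pdivrMr// mulrC ler_pM2l//; lra.
Qed.

Lemma l2approx_sum (I : Type) (s : seq I) (u : I -> Cantor -> R) :
  (forall i, l2approx (u i)) -> l2approx (fun x => \sum_(i <- s) u i x).
Proof.
move=> hu; elim: s => [|i s IHs].
  by under [fun _ => _]funext do rewrite big_nil; exact: l2approx_cst.
by under [fun _ => _]funext do rewrite big_cons; exact: l2approxD.
Qed.

Lemma l2approx_dominated (v : nat -> Cantor -> R) (u g : Cantor -> R) :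
  (forall n, l2approx (v n)) -> measurable_fun setT u ->
  (forall x, (fun n => v n x) @ \oo --> u x) ->
  P.-integrable setT (EFin \o (g \o vec X)) ->
  (forall n x, (u x - v n x) ^+ 2 <= g x) -> l2approx u.
Proof.
move=> hv mu cv ig dom; apply: l2approx_close => // e e0.
have muX : measurable_fun setT (u \o vec X) by exact: measurableT_comp.
have mvn n : measurable_fun setT (v n \o vec X).
  by apply: measurableT_comp => //; have [] := hv n.
have [|||_ _ +] := @dominated_convergence _ Omega R P setT measurableT
  (fun n w => ((u (vec X w) - v n (vec X w)) ^+ 2)%:E) (fun=> 0%E) (EFin \o (g \o vec X))
  (fun n => msq muX (mvn n)) _ _ ig.
- exact: measurable_cst.
- apply: aeW => w _; apply: cvg_EFin; first by near=> n.
  suff : (fun n => (u (vec X w) - v n (vec X w)) ^+ 2) @ \oo --> (u (vec X w) - u (vec X w)) ^+ 2.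
    by rewrite subrr expr0n.
  apply: (@cvg_comp _ _ _ (fun n => u (vec X w) - v n (vec X w)) (fun y => y ^+ 2)).
    by apply: cvgB; [exact: cvg_cst|exact: cv].
  exact: exprn_continuous.
- apply: aeW => w n _ /=; rewrite ger0_norm ?sqr_ge0// lee_fin; exact: dom.
rewrite integral0 => /fine_cvgP[fin cvg0].
move/cvgrPdist_le: cvg0 => /(_ _ e0) cvg0.
have [N _ hN] := cvg0; have [M _ hM] := fin.
(* [fine] sends infinite values to 0, so its smallness is informative only where the integral is
   finite: the index must exceed both ranks. *)
exists (v (maxn N M)) => //.
have fN := hN (maxn N M) (leq_maxl _ _); have fM := hM (maxn N M) (leq_maxr _ _).
rewrite /= in fN fM; rewrite /sqd -(fineK fM) lee_fin; apply: le_trans fN.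
by rewrite sub0r normrN ler_norm.
Unshelve. all: by end_near. Qed.

Lemma l2approx_prefix (A : set Cantor) : prefix_sets A -> l2approx \1_A.
Proof.
move=> [n [S AE]]; split.
  apply: measurable_indic; rewrite measurable_prefix_sets; apply: sub_sigma_algebra.
  by exists n, S.
move=> e e0; exists n, (fun s => (S s)%:R); rewrite /sqd.
under eq_integral => w _.
  have -> : (\1_A \o vec X) w = (S (pre n w))%:R :> R.
    rewrite /= indicE AE; congr (_%:R); congr nat_of_bool.
    by apply/idP/idP; rewrite inE.
  rewrite subrr expr0n/=; over.
by rewrite integral0 lee_fin ltW.
Qed.

(** Approximable events form a Dynkin class containing the prefix sets; disjoint unions are limits
    of partial sums with error at most 1. *)
Lemma l2approx_indic (A : set Cantor) : measurable A -> l2approx \1_A.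
Proof.
rewrite measurable_prefix_sets.
apply: (@dynkin_induction _ Cantor prefix_sets (fun A => l2approx \1_A)
  measurable_prefix_sets prefix_sets_setI).
- by rewrite indicT; exact: l2approx_cst.
- exact: l2approx_prefix.
- move=> S mS hS.
  rewrite (_ : \1_(~` S) = (fun x => 1 + -1 * \1_S x) :> (Cantor -> R)).
    by apply: l2approxD; [exact: l2approx_cst|exact: l2approxZ].
  apply/funext => x; rewrite !indicE in_setC.
  by case: (x \in S); rewrite /= ?mulr1n ?mulr0n; ring.
- move=> F mF tF hF.
  pose v n (x : Cantor) : R := \sum_(k <- iota 0 n) \1_(F k) x.
  have vE x k0 n : F k0 x -> v n x = (k0 \in iota 0 n)%:R.
    move=> Fx.
    have z k : k != k0 -> \1_(F k) x = 0 :> R.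
      move=> kk0; rewrite indicE memNset// => Fkx.
      move/trivIsetP: tF => /(_ k k0 Logic.I Logic.I kk0).
      by move/seteqP => [/(_ x) + _]; apply.
    case: (boolP (k0 \in iota 0 n)) => k0n.
      rewrite /v (bigD1_seq k0)//=; last exact: iota_uniq.
      by rewrite indicE mem_set//= big1 ?addr0// => k /z.
    rewrite /v big_seq_cond big1// => k /andP[kn _]; apply: z.
    by apply: contra k0n => /eqP <-.
  have v0 x n : (forall k, ~ F k x) -> v n x = 0.
    by move=> nF; rewrite /v big1// => k _; rewrite indicE memNset.
  apply: (@l2approx_dominated v _ (fun=> 1)).
  - by move=> n; apply: l2approx_sum.
  - by apply: measurable_indic; exact: bigcup_measurable.
  - move=> x; case: (pselect ((\bigcup_k F k) x)) => [[k0 _ Fx]|nx].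
      rewrite indicE mem_set; last by exists k0.
      apply: cvg_near_cst; exists k0.+1 => // n /= kn.
      by rewrite (vE x k0)// mem_iota add0n kn.
    rewrite indicE memNset//; apply: cvg_near_cst; near=> n.
    by apply: v0 => k Fk; apply: nx; exists k.
  - exact: finite_measure_integrable_cst.
  - move=> n x; case: (pselect ((\bigcup_k F k) x)) => [[k0 _ Fx]|nx].
      rewrite indicE mem_set; last by exists k0.
      by rewrite (vE x k0)//; case: (_ \in _); rewrite /= ?mulr1n ?mulr0n; lra.
    by rewrite indicE memNset// v0 ?subrr ?expr0n ?ler01// => k Fk; apply: nx; exists k.
Unshelve. all: by end_near. Qed.

Import HBNNSimple.

(** Simple functions increasing to [u] have squared error at most [u ^ 2], which serves as the
    dominating function. *)
Lemma l2approx_nonneg (u : Cantor -> R) : measurable_fun setT u -> (forall x, 0 <= u x) ->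
  P.-integrable setT (EFin \o (fun w => u (vec X w) ^+ 2)) -> l2approx u.
Proof.
move=> mu u0 iu.
have muE : measurable_fun setT (EFin \o u) by exact/measurable_EFinP.
have uE0 x : setT x -> (0 <= (EFin \o u) x)%E by rewrite lee_fin.
pose h := nnsfun_approx measurableT muE.
have hu n x : h n x <= u x.
  by rewrite -lee_fin /h nnsfun_approxE; exact: le_approx.
have h0 n x : 0 <= h n x by [].
apply: (@l2approx_dominated (fun n => h n) u (fun x => u x ^+ 2)) => //.
- move=> n.
  rewrite (funext (fimfunEord (h n))).
  apply: l2approx_sum => i; apply: l2approxZ; apply: l2approx_indic.
  exact: measurable_funPTI.
- move=> x; have := cvg_nnsfun_approx measurableT muE uE0 (x := x) Logic.I.
  by move=> /fine_cvgP[_].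
- by move=> n x; have := hu n x; have := h0 n x; nra.
Qed.

Lemma l2approx_square_integrable (u : Cantor -> R) : measurable_fun setT u ->
  P.-integrable setT (EFin \o (fun w => u (vec X w) ^+ 2)) -> l2approx u.
Proof.
move=> mu iu.
have part (k : R -> R) : measurable_fun setT k -> (forall x, 0 <= k x) -> (forall x, k x <= `|x|) ->
    l2approx (k \o u).
  move=> mk k0 kn; apply: l2approx_nonneg.
  - exact: measurableT_comp.
  - by move=> x; exact: k0.
  - apply: (le_integrable measurableT _ _ iu).
      apply/measurable_EFinP; apply: measurable_funX.
      by apply: (@measurableT_comp _ _ _ _ _ _ (k \o u)) => //; exact: measurableT_comp.
    move=> w _ /=; rewrite lee_fin !ger0_norm ?sqr_ge0//.
    by rewrite -[leRHS]real_normK ?num_real// ler_sqr ?nnegrE.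
rewrite (_ : u = fun x => Num.max (u x) 0 + -1 * Num.max (- u x) 0).
  apply: l2approxD; last apply: l2approxZ.
    apply: (part (fun x => Num.max x 0)).
    - by apply: measurable_maxr => //; exact: measurable_cst.
    - by move=> x; rewrite le_max lexx orbT.
    - by move=> x; rewrite ge_max ler_norm normr_ge0.
  apply: (part (fun x => Num.max (- x) 0)).
  - by apply: measurable_maxr; [exact: measurable_funN|exact: measurable_cst].
  - by move=> x; rewrite le_max lexx orbT.
  - by move=> x; rewrite ge_max -normrN ler_norm normr_ge0.
apply/funext => x; case: (leP (u x) 0) => h0; case: (leP (- u x) 0) => h1; lra.
Qed.

End density.

(** * Conditioning on the first bits *)

Section conditional_mean.
Context {R : realType} {d : measure_display} {Omega : measurableType d} (P : probability Omega R).
Variables (p : R) (X : nat -> Omega -> bool).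
Hypothesis hp : 0 < p < 1.
Hypothesis hX : bernoulli_seq P p X.

Let pre n w := mkseq (fun i => X i w) n.

Lemma cube_weight_gt0 s : 0 < cube_weight p s.
Proof.
rewrite /cube_weight; apply: prodr_gt0 => b _; rewrite /bern.
by case: b; case/andP: hp => p0 p1 //; rewrite subr_gt0.
Qed.

Let measurable_atom n z : measurable [set w | pre n w = z].
Proof. by apply: measurable_mkseq; exact: hX.1. Qed.

(* The conditional expectation of [xi] given the first [n] bits. *)
Definition cond_mean (xi : Omega -> R) n s : R :=
  \int[P]_(w in [set w | pre n w = s]) xi w / cube_weight p s.

(** The defining property of a conditional expectation, tested against functions of the prefix;
    every atom has positive weight, so the division in [cond_mean] cancels. *)
Lemma cond_mean_dual xi n (H : seq bool -> R) : P.-integrable setT (EFin \o xi) ->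
  P.-integrable setT (EFin \o (fun w => xi w * H (pre n w))) /\
  \int[P]_w (xi w * H (pre n w)) = cubeE p n (fun s => H s * cond_mean xi n s).
Proof.
move=> ixi.
have [|||h1 h2] := @integral_finite_valued R d Omega P _ (pre n) (allseq bools n) xi H _ _ _ ixi.
- exact: uniq_allseq.
- by move=> w; apply: mem_allseq; [rewrite size_mkseq|case].
- exact: measurable_atom.
split=> //; rewrite h2 cubeE_sum; apply: eq_bigr => s _.
rewrite /cond_mean mulrCA; congr (_ * _).
by rewrite mulrC divfK// gt_eqF// cube_weight_gt0.
Qed.

Section square_integrable.
Variable xi : Omega -> R.
Hypothesis ixi : P.-integrable setT (EFin \o xi).
Hypothesis ixi2 : P.-integrable setT (EFin \o (fun w => xi w ^+ 2)).

Lemma cond_mean_sqd n (H : seq bool -> R) :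
  P.-integrable setT (EFin \o (fun w => (xi w - H (pre n w)) ^+ 2)) /\
  \int[P]_w (xi w - H (pre n w)) ^+ 2 =
  \int[P]_w xi w ^+ 2 - 2 * cubeE p n (fun s => H s * cond_mean xi n s)
  + cubeE p n (fun s => H s ^+ 2).
Proof.
have [i1 e1] := cond_mean_dual n H ixi.
have [i2 e2] := hX.2 n (fun s => H s ^+ 2).
have i1' : P.-integrable setT (EFin \o (fun w => 2 * (xi w * H (pre n w)))).
  by have := integrableZl measurableT 2 i1.
have i3 : P.-integrable setT (EFin \o (fun w => xi w ^+ 2 - 2 * (xi w * H (pre n w)))).
  by have := integrableB measurableT ixi2 i1'.
have -> : (fun w => (xi w - H (pre n w)) ^+ 2) =
    (fun w => (xi w ^+ 2 - 2 * (xi w * H (pre n w))) + H (pre n w) ^+ 2).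
  by apply/funext => w; ring.
split; first by have := integrableD measurableT i3 i2.
by rewrite RintegralD// RintegralB// RintegralZl// e1 e2.
Qed.

Lemma cond_mean_mean n : cubeE p n (cond_mean xi n) = \int[P]_w xi w.
Proof.
have [_] := cond_mean_dual n (fun=> 1) ixi.
under eq_Rintegral do rewrite mulr1.
by move=> ->; apply: cubeE_eq => s; rewrite mul1r.
Qed.

Lemma cond_mean_sqr_le n : cubeE p n (fun s => cond_mean xi n s ^+ 2) <= \int[P]_w xi w ^+ 2.
Proof.
have [_ e] := cond_mean_sqd n (cond_mean xi n).
have : 0 <= \int[P]_w (xi w - cond_mean xi n (pre n w)) ^+ 2.
  by apply: Rintegral_ge0 => w _; exact: sqr_ge0.
rewrite e.
have -> : cubeE p n (fun s => cond_mean xi n s * cond_mean xi n s) =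
  cubeE p n (fun s => cond_mean xi n s ^+ 2) by apply: cubeE_eq => s; rewrite expr2.
lra.
Qed.

(** Orthogonal projection: the two errors differ by the squared distance of [H] from the conditional
    mean. Hence any approximation by a cylinder function is also one by conditional means. *)
Lemma cond_mean_closest n (H : seq bool -> R) :
  \int[P]_w (xi w - cond_mean xi n (pre n w)) ^+ 2 <= \int[P]_w (xi w - H (pre n w)) ^+ 2.
Proof.
have [_ ->] := cond_mean_sqd n (cond_mean xi n).
have [_ ->] := cond_mean_sqd n H.
set F := cond_mean xi n.
have := @cubeE_ge0 R p hp n (fun s => (H s - F s) ^+ 2) (fun s => sqr_ge0 _).
have -> : cubeE p n (fun s => (H s - F s) ^+ 2) =
   1 * cubeE p n (fun s => H s ^+ 2) + 1 * cubeE p n (fun s => F s ^+ 2 + -2 * (H s * F s)).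
  by rewrite -cubeE_lin; apply: cubeE_eq => s; ring.
have -> : cubeE p n (fun s => F s ^+ 2 + -2 * (H s * F s)) =
   1 * cubeE p n (fun s => F s ^+ 2) + -2 * cubeE p n (fun s => H s * F s).
  by rewrite -cubeE_lin; apply: cubeE_eq => s; ring.
have -> : cubeE p n (fun s => F s * F s) =
  cubeE p n (fun s => F s ^+ 2) by apply: cubeE_eq => s; rewrite expr2.
lra.
Qed.

End square_integrable.

Lemma cube_weight_set_nth s i c : (i < size s)%N ->
  cube_weight p s * bern p c = bern p (nth false s i) * cube_weight p (set_nth false s i c).
Proof.
rewrite /cube_weight; elim: s i => [//|b s IHs] [|i] /= si; rewrite !big_cons; first by ring.
by rewrite -mulrA (IHs i)// mulrCA.
Qed.

Lemma sigma_but_atom i n s :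
  sigma_but X i [set w | forall j, (j < n)%N -> j != i -> X j w = nth false s j].
Proof.
pose G : set (set Omega) := \bigcup_(j in [set j | j <> i]) sigma_of (X j).
suff : @measurable _ (g_sigma_algebraType G)
    [set w | forall j, (j < n)%N -> j != i -> X j w = nth false s j] by [].
elim: n => [|n IHn].
  rewrite (_ : mkset _ = setT); first exact: measurableT.
  by apply/seteqP; split.
have [ni|ni] := eqVneq n i.
  rewrite (_ : mkset _ = [set w | forall j, (j < n)%N -> j != i -> X j w = nth false s j])//.
  apply/seteqP; split => w /= h j jn ji; apply: h => //; first exact: ltnW.
  by move: jn; rewrite ltnS leq_eqVlt => /orP[/eqP jn|//]; rewrite jn ni eqxx in ji.
rewrite (_ : mkset _ = [set w | forall j, (j < n)%N -> j != i -> X j w = nth false s j] `&`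
    X n @^-1` [set nth false s n]).
  apply: (@measurableI _ (g_sigma_algebraType G)) => //.
  apply: sub_sigma_algebra; exists n; first exact/eqP.
  by exists [set nth false s n].
apply/seteqP; split => w /=.
  by move=> h; split; [move=> j jn; apply: h; exact: ltnW|apply: h].
move=> [h1 h2] j; rewrite ltnS leq_eqVlt => /orP[/eqP -> _|]; [exact: h2|exact: h1].
Qed.

Lemma atom_sigma_but i n s c : size s = n -> (i < n)%N ->
  [set w | pre n w = set_nth false s i c] =
  [set w | forall j, (j < n)%N -> j != i -> X j w = nth false s j] `&` [set w | X i w = c].
Proof.
move=> sn ni; apply/seteqP; split => w /=.
  move=> E; split.
    move=> j jn ji; have := congr1 (fun u => nth false u j) E.
    by rewrite nth_mkseq// nth_set_nth/= (negbTE ji).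
  by have := congr1 (fun u => nth false u i) E; rewrite nth_mkseq// nth_set_nth/= eqxx.
move=> [h1 h2]; apply: (@eq_from_nth _ false).
  by rewrite size_mkseq size_set_nth sn; apply/esym/maxn_idPr.
move=> j; rewrite size_mkseq => jn; rewrite nth_mkseq// nth_set_nth/=.
by case: eqP => [->//|/eqP ji]; exact: h1.
Qed.

(** The two conditionings commute: projecting [h], the conditional expectation given the bits other
    than [i], on the first [n] bits amounts to resampling bit [i] in the projection of [xi]. On an
    atom, bit [i] factors out of the integral of [h] by independence; without it, [h] and [xi] have
    the same integral over [B], the union of the two atoms that differ at [i]. *)
Lemma cond_mean_resample xi h i n s : P.-integrable setT (EFin \o xi) ->
  is_cond_exp P (sigma_but X i) xi h -> size s = n -> (i < n)%N ->
  cube_weight p s * resample p i (cond_mean xi n) s = \int[P]_(w in [set w | pre n w = s]) h w.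
Proof.
move=> ixi [mh ih eh] sn ni.
set B := [set w | forall j, (j < n)%N -> j != i -> X j w = nth false s j].
have GB : sigma_but X i B by exact: sigma_but_atom.
have [mB _] := bernoulli_seq_indep true hp hX GB.
have sE : s = set_nth false s i (nth false s i).
  apply: (@eq_from_nth _ false); first by rewrite size_set_nth sn; apply/esym/maxn_idPr.
  by move=> j _; rewrite nth_set_nth/=; case: eqP => [->|].
have bern0 c : 0 <= bern p c by rewrite /bern; case: c; case/andP: hp => p0 p1; rewrite ?subr_ge0 ltW.
have -> : \int[P]_(w in [set w | pre n w = s]) h w = bern p (nth false s i) * \int[P]_(w in B) h w.
  rewrite {1}sE (atom_sigma_but _ sn ni) -/B.
  apply: Rintegral_indep => //; first exact: hX.1.
  move=> A mA; apply: (bernoulli_seq_indep _ hp hX _).2.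
  pose G : set (set Omega) := \bigcup_(j in [set j | j <> i]) sigma_of (X j).
  by apply: (@measurableI _ (g_sigma_algebraType G)); [exact: mh|exact: GB].
have -> : \int[P]_(w in B) h w = \int[P]_(w in B) xi w by rewrite /Rintegral eh.
have BE : B = [set w | pre n w = set_nth false s i true] `|` [set w | pre n w = set_nth false s i false].
  rewrite !(atom_sigma_but _ sn ni) -/B -setIUr; apply/seteqP; split => w //=; last by case.
  by move=> Bw; split=> //; case: (X i w); [left|right].
rewrite BE Rintegral_setU//; last 2 first.
- by apply: integrableS ixi => //; exact: measurableU.
- rewrite disj_set2E; apply/eqP/seteqP; split => w //= [-> /(congr1 (fun u => nth false u i))].
  by rewrite !nth_set_nth/= eqxx.
rewrite /resample mulrDr.
have E c : cube_weight p s * (bern p c * cond_mean xi n (set_nth false s i c)) =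
    bern p (nth false s i) * \int[P]_(w in [set w | pre n w = set_nth false s i c]) xi w.
  rewrite mulrA (@cube_weight_set_nth s i c) ?sn// -mulrA; congr (_ * _).
  by rewrite /cond_mean mulrC divfK// gt_eqF// cube_weight_gt0.
by rewrite mulrDr -(E true) -(E false).
Qed.

(** By [cond_mean_resample] the left-hand side is the L^1 norm of the projection of [h - xi], and
    averaging over atoms contracts L^1 norms. *)
Lemma cond_mean_influence xi h i n : P.-integrable setT (EFin \o xi) ->
  is_cond_exp P (sigma_but X i) xi h -> (i < n)%N ->
  ((cube_inf p n i (cond_mean xi n))%:E <= influence P xi h)%E.
Proof.
move=> ixi ce ni; have [_ ih _] := ce.
have id_ : P.-integrable setT (EFin \o (fun w => h w - xi w)).
  by have := integrableB measurableT ih ixi.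
have idn : P.-integrable setT (EFin \o (fun w => `|h w - xi w|)) by exact: integrable_norm.
have -> : influence P xi h = (\int[P]_w `|h w - xi w|)%:E.
  by rewrite /influence unlock /Rintegral fineK//; exact: integrable_fin_num.
rewrite lee_fin.
have [_] := cond_mean_dual n (fun=> 1) idn.
under eq_Rintegral do rewrite mulr1.
move=> ->; rewrite /cube_inf !cubeE_sum.
rewrite big_seq_cond [leRHS]big_seq_cond; apply: ler_sum => s; rewrite andbT => sL.
have sn := size_allseq sL.
have w0 := cube_weight_gt0 s.
rewrite mul1r /cond_mean [leRHS]mulrC divfK ?gt_eqF//.
rewrite -[X in X * `|_|](gtr0_norm w0) -normrM mulrBr -/(cond_mean xi n s).
rewrite (cond_mean_resample ixi ce sn ni) {1}/cond_mean [X in X - _]mulrC divfK ?gt_eqF//.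
have iS k : P.-integrable setT (EFin \o k) -> P.-integrable [set w | pre n w = s] (EFin \o k).
  by move=> ik; apply: integrableS ik => //; exact: measurable_atom.
rewrite distrC -RintegralB//; try exact: iS.
by apply: le_normr_Rintegral; [exact: measurable_atom|exact: iS].
Qed.

End conditional_mean.

(** * Reduction of the covariance to finitely many bits *)

Section approximation.
Context {R : realType} {d : measure_display} {Omega : measurableType d} (P : probability Omega R).

Lemma integrable_sqr (u : Omega -> R) : measurable_fun setT u ->
  P.-integrable setT (EFin \o (fun w => u w ^+ 2)) -> P.-integrable setT (EFin \o u).
Proof.
move=> mu iu.
have i1 : P.-integrable setT (EFin \o (fun w => u w ^+ 2 + 1)).
  by have := integrableD measurableT iu (finite_measure_integrable_cst P 1 measurableT).
apply: (le_integrable measurableT _ _ i1); first exact/measurable_EFinP.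
move=> w _ /=; rewrite lee_fin [leRHS]ger0_norm ?addr_ge0 ?sqr_ge0//.
by rewrite -[X in _ <= X + _]real_normK ?num_real//; set x := `|u w|; have := sqr_ge0 (x - 1); nra.
Qed.

Lemma integrable_mul_sqr (u v : Omega -> R) : measurable_fun setT u -> measurable_fun setT v ->
  P.-integrable setT (EFin \o (fun w => u w ^+ 2)) ->
  P.-integrable setT (EFin \o (fun w => v w ^+ 2)) ->
  P.-integrable setT (EFin \o (fun w => u w * v w)).
Proof.
move=> mu mv iu iv.
have i1 : P.-integrable setT (EFin \o (fun w => u w ^+ 2 + v w ^+ 2)).
  by have := integrableD measurableT iu iv.
apply: (le_integrable measurableT _ _ i1).
  by apply/measurable_EFinP; exact: measurable_funM.
move=> w _ /=; rewrite lee_fin [leRHS]ger0_norm ?addr_ge0 ?sqr_ge0// normrM.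
rewrite -[X in _ <= X + _]real_normK ?num_real// -[X in _ <= _ + X]real_normK ?num_real//.
set x := `|u w|; set y := `|v w|; have := sqr_ge0 (x - y); have := sqr_ge0 (x + y); nra.
Qed.

Lemma expectation_Rintegral (u : Omega -> R) : P.-integrable setT (EFin \o u) ->
  'E_P[u]%E = (\int[P]_w u w)%:E.
Proof. by move=> iu; rewrite unlock /Rintegral fineK//; exact: integrable_fin_num. Qed.

Lemma covariance_Rintegral (u v : Omega -> R) : P.-integrable setT (EFin \o u) ->
  P.-integrable setT (EFin \o v) -> P.-integrable setT (EFin \o (fun w => u w * v w)) ->
  covariance P u v = (\int[P]_w (u w * v w) - \int[P]_w u w * \int[P]_w v w)%:E.
Proof.
move=> iu iv iuv; rewrite covarianceE; try exact/Lfun1_integrable.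
by rewrite !expectation_Rintegral// EFinB EFinM.
Qed.

Lemma measurable_prefix_fun n (H : seq bool -> R) :
  measurable_fun setT (fun x : Cantor => H (mkseq x n)).
Proof.
move=> _ B mB; rewrite setTI.
have := @measurable_prefix _ Cantor (fun i x => x i) n (fun s => `[< B (H s) >]) measurable_coord.
by rewrite (_ : mkset _ = (fun x : Cantor => H (mkseq x n)) @^-1` B)//; apply/seteqP; split => x /= /asboolP.
Qed.

Section pair.
Variables (p r : R) (X Y : nat -> Omega -> bool).
Hypothesis hp : 0 < p < 1.
Hypothesis hX : bernoulli_seq P p X.
Hypothesis hY : bernoulli_seq P p Y.
Hypothesis hXY : forall n (F G : seq bool -> R),
  P.-integrable setT (EFin \o (fun w => F (mkseq (fun i => X i w) n) * G (mkseq (fun i => Y i w) n))) /\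
  \int[P]_w (F (mkseq (fun i => X i w) n) * G (mkseq (fun i => Y i w) n)) = cubeT p r n F G.

Let cm (f : Cantor -> R) n := cond_mean P p X (f \o vec X) n.

(** One length must serve both functions: approximants of lengths [n] and [m] are also functions of
    the first [n + m] bits, and the conditional means at that length do at least as well. *)
Lemma cond_mean_dense (f g : Cantor -> R) (e : R) : 0 < e ->
  measurable_fun setT f -> measurable_fun setT g ->
  P.-integrable setT (EFin \o (fun w => f (vec X w) ^+ 2)) ->
  P.-integrable setT (EFin \o (fun w => g (vec X w) ^+ 2)) ->
  exists n, \int[P]_w (f (vec X w) - cm f n (mkseq (fun i => X i w) n)) ^+ 2 <= e /\
            \int[P]_w (g (vec X w) - cm g n (mkseq (fun i => X i w) n)) ^+ 2 <= e.
Proof.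
move=> e0 mf mg if2 ig2.
have mvX := measurable_vec hX.1.
have [_ /(_ _ e0) [n [H hH]]] := l2approx_square_integrable hX mf if2.
have [_ /(_ _ e0) [m [G hG]]] := l2approx_square_integrable hX mg ig2.
exists (n + m)%N; split.
  apply: (le_trans (cond_mean_closest hp hX (integrable_sqr (measurableT_comp mf mvX) if2) if2 _ (fun s => H (take n s)))).
  rewrite -lee_fin /Rintegral fineK; last first.
    apply: integrable_fin_num => //.
    exact: (cond_mean_sqd hp hX (integrable_sqr (measurableT_comp mf mvX) if2) if2 _ (fun s => H (take n s))).1.
  by under eq_integral do rewrite take_mkseq_add.
apply: (le_trans (cond_mean_closest hp hX (integrable_sqr (measurableT_comp mg mvX) ig2) ig2 _ (fun s => G (take m s)))).
rewrite -lee_fin /Rintegral fineK; last first.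
  apply: integrable_fin_num => //.
  exact: (cond_mean_sqd hp hX (integrable_sqr (measurableT_comp mg mvX) ig2) ig2 _ (fun s => G (take m s))).1.
by under eq_integral do rewrite addnC take_mkseq_add.
Qed.

Lemma Rintegral_pair_le (f g : Cantor -> R) (e : R) : 0 < e ->
  measurable_fun setT f -> measurable_fun setT g ->
  P.-integrable setT (EFin \o (fun w => f (vec X w) ^+ 2)) ->
  P.-integrable setT (EFin \o (fun w => g (vec X w) ^+ 2)) ->
  exists n, \int[P]_w (f (vec X w) * g (vec Y w)) <= cubeT p r n (cm f n) (cm g n) + e.
Proof.
move=> e0 mf mg if2 ig2.
have mvX := measurable_vec hX.1; have mvY := measurable_vec hY.1.
have mfX := measurableT_comp mf mvX; have mgX := measurableT_comp mg mvX.
have mgY := measurableT_comp mg mvY.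
have [ig2Y eg2Y] := @bernoulli_seq_integral R d Omega P p X Y (fun x => g x ^+ 2) hX hY
  (measurable_funX 2 mg) ig2.
set a := \int[P]_w f (vec X w) ^+ 2; set b := \int[P]_w g (vec X w) ^+ 2.
have a0 : 0 <= a by apply: Rintegral_ge0 => w _; exact: sqr_ge0.
have b0 : 0 <= b by apply: Rintegral_ge0 => w _; exact: sqr_ge0.
(* With squared approximation errors at most [de ^ 2], the four error terms below add up to at most
   [de * (1 + (a + b) / 2)], which is below [de * D = e]. *)
pose D := 2 + a + b; have D0 : 0 < D by rewrite /D; lra.
pose de := e / D; have de0 : 0 < de by rewrite divr_gt0.
have de20 : 0 < de ^+ 2 by rewrite exprn_gt0.
have [n [hf hg]] := cond_mean_dense de20 mf mg if2 ig2.
exists n; set F := cm f n; set G := cm g n.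
pose xX w := mkseq (fun i => X i w) n; pose xY w := mkseq (fun i => Y i w) n.
have [iFG eFG] := hXY n F G.
have [iF2 eF2] := hX.2 n (fun s => F s ^+ 2).
have [i1 _] := cond_mean_sqd hp hX (integrable_sqr mfX if2) if2 n F.
have [i2X _] := cond_mean_sqd hp hX (integrable_sqr mgX ig2) ig2 n G.
have mphi : measurable_fun setT (fun x : Cantor => (g x - G (mkseq x n)) ^+ 2).
  by apply: measurable_funX; apply: measurable_funB => //; exact: measurable_prefix_fun.
(* The approximation of [g] was obtained along [X]; equality of laws carries its error over to
   [Y]. *)
have [i2 e2] := bernoulli_seq_integral hX hY mphi i2X.
have iprod := integrable_mul_sqr mfX mgY if2 ig2Y.
have Dd u v : P.-integrable setT (EFin \o u) -> P.-integrable setT (EFin \o v) ->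
    P.-integrable setT (EFin \o (fun w => u w + v w)) /\
    \int[P]_w (u w + v w) = \int[P]_w u w + \int[P]_w v w.
  by move=> iu iv; split; [have := integrableD measurableT iu iv|rewrite RintegralD].
have Zz c u : P.-integrable setT (EFin \o u) -> P.-integrable setT (EFin \o (fun w => c * u w)) /\
    \int[P]_w (c * u w) = c * \int[P]_w u w.
  by move=> iu; split; [have := integrableZl measurableT c iu|rewrite RintegralZl].
have [j1 k1] := Zz (2 * de)^-1 _ i1; have [j2 k2] := Zz (2 * de)^-1 _ i2.
have [j3 k3] := Zz (de / 2) _ ig2Y; have [j4 k4] := Zz (de / 2) _ iF2.
have [l1 m1] := Dd _ _ iFG j1; have [l2 m2] := Dd _ _ l1 j2.
have [l3 m3] := Dd _ _ l2 j3; have [l4 m4] := Dd _ _ l3 j4.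
apply: (@le_trans _ _ (\int[P]_w (F (xX w) * G (xY w) + (2 * de)^-1 * (f (vec X w) - F (xX w)) ^+ 2
   + (2 * de)^-1 * (g (vec Y w) - G (xY w)) ^+ 2 + de / 2 * g (vec Y w) ^+ 2 + de / 2 * F (xX w) ^+ 2))).
  apply: le_Rintegral => //.
  (* AM-GM for both terms of [x y - F G = (x - F) y + F (y - G)] *)
  move=> w _; set x := f (vec X w); set y := g (vec Y w); set u := F (xX w); set v := G (xY w).
  have h1 : (x - u) * y <= (2 * de)^-1 * (x - u) ^+ 2 + de / 2 * y ^+ 2.
    rewrite -subr_ge0.
    have -> : (2 * de)^-1 * (x - u) ^+ 2 + de / 2 * y ^+ 2 - (x - u) * y =
      (2 * de)^-1 * ((x - u) - de * y) ^+ 2 by field; rewrite gt_eqF.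
    by rewrite mulr_ge0 ?sqr_ge0// invr_ge0 mulr_ge0// ltW.
  have h2 : u * (y - v) <= (2 * de)^-1 * (y - v) ^+ 2 + de / 2 * u ^+ 2.
    rewrite -subr_ge0.
    have -> : (2 * de)^-1 * (y - v) ^+ 2 + de / 2 * u ^+ 2 - u * (y - v) =
      (2 * de)^-1 * ((y - v) - de * u) ^+ 2 by field; rewrite gt_eqF.
    by rewrite mulr_ge0 ?sqr_ge0// invr_ge0 mulr_ge0// ltW.
  have -> : x * y = u * v + (x - u) * y + u * (y - v) by ring.
  by lra.
rewrite m4 m3 m2 m1 k1 k2 k3 k4 eFG eF2 -!addrA lerD2l -e2 -eg2Y -/b.
have hF : cubeE p n (fun s => F s ^+ 2) <= a.
  exact: (cond_mean_sqr_le hp hX (integrable_sqr mfX if2) if2).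
set A1 := \int[P]_w _ in hf *; set A2 := \int[P]_w _ in hg *.
have h1 : (2 * de)^-1 * A1 <= de / 2.
  rewrite (_ : de / 2 = (2 * de)^-1 * de ^+ 2); last by field; rewrite gt_eqF.
  by rewrite ler_pM2l// invr_gt0 mulr_gt0.
have h2 : (2 * de)^-1 * A2 <= de / 2.
  rewrite (_ : de / 2 = (2 * de)^-1 * de ^+ 2); last by field; rewrite gt_eqF.
  by rewrite ler_pM2l// invr_gt0 mulr_gt0.
have h3 : de / 2 * cubeE p n (fun s => F s ^+ 2) <= de / 2 * a.
  by rewrite ler_pM2l// divr_gt0.
have eE : e = de * D by rewrite /de divfK// gt_eqF.
have : 0 <= de * a by rewrite mulr_ge0// ltW.
have : 0 <= de * b by rewrite mulr_ge0// ltW.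
rewrite eE /D; lra.
Qed.

End pair.
End approximation.

Theorem theorem1p2 (R : realType) (p t : R) (hp : 0 < p < 1) (ht : 0 < t)
  (d : measure_display) (Omega : measurableType d) (P : probability Omega R)
  (X X' : nat -> {RV P >-> bool}) (U : nat -> {RV P >-> R})
  (hX : forall i, distribution P (X i) = bernoulli_prob p)
  (hX' : forall i, distribution P (X' i) = bernoulli_prob p)
  (hU : forall i, distribution P (U i) = exponential_prob 1)
  (hind : mutually_independent P (fun k : nat * src =>
     match k.2 with
     | srcX => sigma_of (X k.1)
     | srcX' => sigma_of (X' k.1)
     | srcU => sigma_of (U k.1)
     end)) :
  0 < theta p t /\
  forall (f g : Cantor -> R),
    measurable_fun setT f -> measurable_fun setT g ->
    (f \o vec (fun i => X i)) \in Lfun P 2%:E ->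
    (g \o vec (fun i => X i)) \in Lfun P 2%:E ->
    forall hf hg : nat -> Omega -> R,
    (forall i, is_cond_exp P (sigma_but (fun j => X j) i) (f \o vec (fun j => X j)) (hf i)) ->
    (forall i, is_cond_exp P (sigma_but (fun j => X j) i) (g \o vec (fun j => X j)) (hg i)) ->
    (covariance P (f \o vec (fun i => X i))
                  (g \o noised t (fun i => X i) (fun i => X' i) (fun i => U i))
     <= (Num.sqrt (fine ('V_P[f \o vec (fun i => X i)] * 'V_P[g \o vec (fun i => X i)]))
          `^ (1 - theta p t))%:E
        * poweR (\sum_(0 <= i <oo)
                   (influence P (f \o vec (fun j => X j)) (hf i)
                    * influence P (g \o vec (fun j => X j)) (hg i)))
                (theta p t))%E.
Proof.
split; first exact: theta_gt0.
move=> f g mf mg /Lfun2_integrable_sqr if2 /Lfun2_integrable_sqr ig2 hf hg cef ceg.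
pose Xb i (w : Omega) : bool := X i w.
pose Yb i (w : Omega) : bool := if t < U i w then X i w else X' i w.
have mXY k ab : measurable [set w | (Xb k w, Yb k w) = ab] by exact: measurable_XY.
have lawXY n z : size z = n ->
    P [set w | mkseq (fun i => (Xb i w, Yb i w)) n = z] =
    (\prod_(ab <- z) joint_weight p (expR (- t)) ab)%:E.
  exact: (joint_law hp ht hX hX' hU hind).
have bX : bernoulli_seq P p Xb.
  split; last exact: (Rintegral_fst mXY lawXY).
  move=> i c; rewrite (_ : mkset _ = [set w | (Xb i w, Yb i w) = (c, true)] `|` [set w | (Xb i w, Yb i w) = (c, false)]).
    exact: measurableU.
  apply/seteqP; split => w /=; last by case=> -[].
  by move=> ->; case: (Yb i w); [left|right].
have bY : bernoulli_seq P p Yb.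
  split; last exact: (Rintegral_snd mXY lawXY).
  move=> i c; rewrite (_ : mkset _ = [set w | (Xb i w, Yb i w) = (true, c)] `|` [set w | (Xb i w, Yb i w) = (false, c)]).
    exact: measurableU.
  apply/seteqP; split => w /=; last by case=> -[].
  by move=> ->; case: (Xb i w); [left|right].
have hXY := Rintegral_pair mXY lawXY.
have mvX := measurable_vec bX.1; have mvY := measurable_vec bY.1.
have mfX := measurableT_comp mf mvX; have mgX := measurableT_comp mg mvX.
have mgY := measurableT_comp mg mvY.
have ifX := integrable_sqr mfX if2; have igX := integrable_sqr mgX ig2.
have [ig2Y _] := @bernoulli_seq_integral R d Omega P p Xb Yb (fun x => g x ^+ 2) bX bY
  (measurable_funX 2 mg) ig2.
have [igY egY] := bernoulli_seq_integral bX bY mg igX.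
have iprod := integrable_mul_sqr mfX mgY if2 ig2Y.
set th := theta p t.
have th0 : 0 < th by exact: theta_gt0.
pose q := 1 + expR (- (rho p * t)).
have e01 : 0 < expR (- (rho p * t)) < 1.
  by rewrite expR_gt0 /= -[ltRHS]expR0 ltr_expR oppr_lt0 mulr_gt0// rho_gt0.
have hq : 1 < q < 2 by rewrite /q; lra.
have thE : th = (2 - q) / q.
  by rewrite /th theta_expR /q; congr (_ / _); ring.
have th1 : th < 1 by rewrite thE ltr_pdivrMr; lra.
have hr : 0 <= expR (- t) <= 1 by rewrite expR_ge0/= -[leRHS]expR0 ler_expR; lra.
have two_pt (a b c e : R) : 0 <= a -> 0 <= b -> 0 <= c -> 0 <= e -> _ :=
  @two_point_hypercontractive_bilinear R p (rho p) hp (rho_gt0 hp) (rho_logit hp) (rho_le1 hp) t a b c e ht.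
have VE (u : Cantor -> R) : measurable_fun setT (u \o vec Xb) ->
    P.-integrable setT (EFin \o (fun w => u (vec Xb w) ^+ 2)) ->
    'V_P[u \o vec Xb]%E = (\int[P]_w u (vec Xb w) ^+ 2 - (\int[P]_w u (vec Xb w)) ^+ 2)%:E.
  move=> mu iu2; have iu := integrable_sqr mu iu2.
  have iuu : P.-integrable setT (EFin \o (fun w => (u \o vec Xb) w * (u \o vec Xb) w)).
    exact: integrable_mul_sqr.
  by rewrite /variance (covariance_Rintegral iu iu iuu) [in RHS]expr2.
rewrite (VE f mfX if2) (VE g mgX ig2) -EFinM [fine _]/=.
set vf := (_ - _)%R; set vg := (_ - _)%R.
set K := Num.sqrt _ `^ _.
have K0 : 0 <= K by exact: powR_ge0.
(* Reduction to [n] bits costs an arbitrary [e], while the bound for [n] bits is uniform in [n]. *)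
apply/lee_addgt0Pr => e e0.
rewrite (@covariance_Rintegral R d Omega P (f \o vec Xb) (g \o vec Yb) ifX igY iprod).
have [n hn] := Rintegral_pair_le hp bX bY hXY e0 mf mg if2 ig2.
set F := cond_mean P p Xb (f \o vec Xb) n in hn; set G := cond_mean P p Xb (g \o vec Xb) n in hn.
pose S := \sum_(i < n) cube_inf p n i F * cube_inf p n i G.
have S0 : 0 <= S by apply: sumr_ge0 => i _; rewrite mulr_ge0// cube_inf_ge0.
(* Conditioning keeps means and lowers second moments, so the variances on [n] bits are replaced by
   the true ones. *)
have cube : cubeT p (expR (- t)) n F G - cubeE p n F * cubeE p n G <= K * S `^ th.
  have := @cube_covariance_le R p hp (expR (- t)) q hr hq two_pt n F G.
  rewrite -thE -/S => h; apply: (le_trans h); apply: ler_wpM2r; first exact: powR_ge0.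
  have th1' : 0 <= 1 - th by rewrite subr_ge0 ltW.
  apply: (ge0_ler_powR th1'); rewrite ?nnegrE ?sqrtr_ge0//.
  have Fv : cube_var p n F <= vf.
    rewrite /cube_var (cond_mean_mean hp bX ifX) lerD2r.
    exact: (cond_mean_sqr_le hp bX ifX if2).
  have Gv : cube_var p n G <= vg.
    rewrite /cube_var (cond_mean_mean hp bX igX) lerD2r.
    exact: (cond_mean_sqr_le hp bX igX ig2).
  by rewrite ler_wsqrtr// ler_pM ?cube_var_ge0.
apply: (@le_trans _ _ ((K * S `^ th)%:E + e%:E)%E).
  rewrite -EFinD lee_fin.
  have -> : \int[P]_w (g \o vec Yb) w = cubeE p n G.
    by rewrite -egY (cond_mean_mean hp bX igX).
  have -> : \int[P]_w (f \o vec Xb) w = cubeE p n F by rewrite (cond_mean_mean hp bX ifX).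
  rewrite -lerBlDr; apply: le_trans cube.
  by rewrite lerBlDr -addrA [- _ + e]addrC addrA lerD2r.
apply: leeD => //; rewrite EFinM; apply: lee_wpmul2l; first by rewrite lee_fin.
have inf0 (u h : Omega -> R) : (0 <= influence P u h)%E by rewrite expectation_ge0.
have term0 i : (0 <= influence P (f \o vec Xb) (hf i) * influence P (g \o vec Xb) (hg i))%E.
  by rewrite mule_ge0.
(* Each influence on [n] bits is below the true one, and the partial sum is below the series, whose
   value may be infinite. *)
have SS : (S%:E <= \sum_(0 <= i <oo) (influence P (f \o vec Xb) (hf i) * influence P (g \o vec Xb) (hg i)))%E.
  apply: (@le_trans _ _ (\sum_(0 <= i < n) (influence P (f \o vec Xb) (hf i) * influence P (g \o vec Xb) (hg i)))%E).
    rewrite big_mkord /S -sumEFin; apply: lee_sum => i _; rewrite EFinM.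
    apply: lee_pmul; rewrite ?lee_fin ?cube_inf_ge0//.
      exact: (cond_mean_influence hp bX ifX (cef i)).
    exact: (cond_mean_influence hp bX igX (ceg i)).
  by apply: nneseries_lim_ge => i _ _; exact: term0.
rewrite -poweR_EFin; apply: (gt0_ler_poweR (ltW th0)) => //.
- by rewrite in_itv/= lee_fin S0 leey.
- by rewrite in_itv/= leey andbT nneseries_ge0.
Qed.
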